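(* Let $K$ be an infinite field, let $R=K[x_0,x_1,x_2]=K[\mathbf{P}^2]$, let $M=(x_0,x_1,x_2)$, and let $n\ge 1$. Let $I=\bigcap_{i=1}^n I(p_i)\subset R$ be the radical ideal of $n$ general points $p_1,\dots,p_n\in\mathbf{P}^2$. Then $I^{(2r)}\subseteq M^rI^r$ holds for all $r\ge 1$.
   Context: For a point $p\in\mathbf{P}^2$ (a $K$-rational point), $I(p)\subset R$ is the ideal generated by all forms vanishing at $p$. For $I=\bigcap_i I(p_i)$ with the $p_i$ distinct, the $m$-th symbolic power is $I^{(m)}=\bigcap_i I(p_i)^m$. ''General points'' has its usual meaning: for each $n$ there is a nonempty Zariski-open subset $U\subseteq(\mathbf{P}^2)^n$ such that the assertion (for all $r\geq 1$) holds for every $(p_1,\dots,p_n)\in U$ (in particular the $p_i$ are distinct). *)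

(* Defs.v *)
From mathcomp Require Import all_boot all_order all_algebra.
From mathcomp Require Import classical_sets cardinality.
From mathcomp Require Import mpoly.

Set Implicit Arguments.
Unset Strict Implicit.
Unset Printing Implicit Defensive.

Import GRing.Theory.
Local Open Scope classical_set_scope.
Local Open Scope ring_scope.

Section Ideals.
Variable R : comNzRingType.
Implicit Types (S I J : set R).

Definition is_ideal J : Prop :=
  [/\ J 0, forall f g, J f -> J g -> J (f + g)
    & forall a f, J f -> J (a * f)].

Definition ideal_gen S : set R := smallest is_ideal S.

Definition idealM I J : set R :=
  ideal_gen [set f * g | f in I & g in J].

Definition idealX I (m : nat) : set R := iter m (idealM I) setT.

End Ideals.

Section Points.
Variable K : fieldType.

(* K-rational points of the projective plane: lines through the origin. *)
Definition P2 : Type := {L : {vspace 'rV[K]_3} | \dim L == 1%N}.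

Definition is_coord (p : P2) (v : 'rV[K]_3) : Prop := v \in val p /\ v != 0.

Definition vanishes_at (f : {mpoly K[3]}) (p : P2) : Prop :=
  forall v, is_coord p v -> f.@[fun j => v 0 j] = 0.

Definition point_ideal (p : P2) : set {mpoly K[3]} :=
  ideal_gen [set f | (exists d : nat, f \is d.-homog) /\ vanishes_at f p].

Definition irrelevant_ideal : set {mpoly K[3]} :=
  ideal_gen [set 'X_i | i in [set: 'I_3]].

Section Configurations.
Variable n : nat.
Implicit Types p : 'I_n -> P2.

Definition points_ideal p : set {mpoly K[3]} :=
  \bigcap_(i in [set: 'I_n]) point_ideal (p i).

(* The m-th symbolic power of points_ideal p, for p injective. *)
Definition symbolic_power p (m : nat) : set {mpoly K[3]} :=
  \bigcap_(i in [set: 'I_n]) idealX (point_ideal (p i)) m.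

(* The variable of index mxvec_index i j is the j-th homogeneous coordinate
   of the i-th factor of (P^2)^n. *)
Definition multihomog (d : 'I_n -> nat) (F : {mpoly K[n * 3]}) : Prop :=
  forall m : 'X_{1..n * 3}, m \in msupp F ->
  forall i : 'I_n, (\sum_(j < 3) m (mxvec_index i j))%N = d i.

Definition multi_vanishes_at (F : {mpoly K[n * 3]}) p : Prop :=
  forall v : 'M[K]_(n, 3), (forall i, is_coord (p i) (row i v)) ->
  F.@[fun k => mxvec v 0 k] = 0.

Definition zariski_closed (Z : set ('I_n -> P2)) : Prop :=
  exists S : set {mpoly K[n * 3]},
    (forall F, S F -> exists d, multihomog d F) /\
    Z = [set p | forall F, S F -> multi_vanishes_at F p].

Definition zariski_open (U : set ('I_n -> P2)) : Prop :=
  zariski_closed (~` U).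

Definition for_general_points (A : ('I_n -> P2) -> Prop) : Prop :=
  exists U : set ('I_n -> P2),
    [/\ zariski_open U, U !=set0 & forall p, U p -> A p].

End Configurations.
End Points.

Arguments irrelevant_ideal K : clear implicits.

(* Main.v *)
(** A general point has a representative [(1 : a : b)]; the multiplicity of a form [f]
    there is the order in [t] of [f(1, a + t, b + t y)].  Let [s + 1] be the
    regularity of the ideal [I] of the points, so that [s] is minimal with
    [n <= 'C(s + 2, 2)] and general points impose independent conditions on forms of
    degree [s].

    Upper part: a form of degree at least [r (s + 1)] with multiplicity [r] at all the
    points lies in [I ^ r], and is even generated by products of [r] forms of degree
    [s + 1] of [I].  Inductively such a form is a combination of products of [r - 1] of
    these with forms [e i * x0 ^ k], where [e i] separates the [i]-th point; vanishing
    of the leading terms reduces everything to [B * e i * x0] with [B] in [I] singular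
    at the [i]-th point, where a product decomposition can be written down.

    Lower part: unless [n = 2], a nonzero form with multiplicity [2 r] at all the points
    has degree at least [r (s + 2)], which leaves room for the factor [M ^ r].  By
    Bezout it suffices to find a plane curve through enough of the points that meets
    each of its own components nonnegatively: two lines, two conics, or a curve of
    degree [s - 1] through ['C(s + 1, 2) - 1] points.  For general points such a curve
    is nonsingular at them, and a component of degree [e] passes through fewer than
    ['C(e + 2, 2)] of them; no irreducibility is needed. *)
From HB Require Import structures.
Require Import Defs.
From mathcomp Require Import all_boot all_order all_algebra.
From mathcomp Require Import classical_sets cardinality boolp.
From mathcomp Require Import perm mpoly.
From mathcomp Require Import zify ring.

Set Implicit Arguments.
Unset Strict Implicit.
Unset Printing Implicit Defensive.

Import GRing.Theory.
Local Open Scope ring_scope.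

(** * Unique factorisation *)

Section Ufd.
Variable R : idomainType.
Implicit Types a b c p q : R.

(** The field is only assumed infinite: it need not be algebraically closed, and its characteristic
    is arbitrary. Bezout is therefore obtained as an inequality, by counting dimensions of spaces of
    forms with assigned multiplicities. It needs coprime forms, and unique factorisation in [{mpoly
    K[n]}] supplies the common components to be split off. The constants of the lower part come from
    one computation. A curve of degree [d] through [d(d+3)/2] points meets itself nonnegatively, in
    the assigned count, when [d^2 >= d(d+3)/2], that is, when [d >= 3]. A single line through two
    points, or a conic through five, has count -1, which is why these come in pairs. Multiplicity
    [2r] at the points then gives [d(d+3)/2 * 2r <= t * d], so [t >= r(d+3)], which equals [r(s+2)]
    for [d = s - 1]. Two points are a true exception to the bound: the [2r]-th power of the line
    joining them has degree [2r < 3r]. *)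

Definition divides a b := exists c, b = c * a.

Definition prime_elt p :=
  [/\ p != 0, p \isn't a GRing.unit &
      forall a b, divides p (a * b) -> divides p a \/ divides p b].

Definition ufd := forall a, a != 0 -> exists u (ps : seq R),
  [/\ u \is a GRing.unit, forall p, p \in ps -> prime_elt p
    & a = u * \prod_(p <- ps) p].

Lemma divides_mull a b c : divides a b -> divides a (c * b).
Proof. by move=> [d ->]; exists (c * d); rewrite mulrA. Qed.

Lemma divides_mulr a b c : divides a b -> divides a (b * c).
Proof. by rewrite mulrC; apply: divides_mull. Qed.

Lemma dividesB a b c : divides a b -> divides a c -> divides a (b - c).
Proof. by move=> [x ->] [y ->]; exists (x - y); rewrite mulrBl. Qed.

Lemma dividesD a b c : divides a b -> divides a c -> divides a (b + c).
Proof. by move=> [x ->] [y ->]; exists (x + y); rewrite mulrDl. Qed.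

Lemma divides0 a : divides a 0.
Proof. by exists 0; rewrite mul0r. Qed.

Lemma divides_refl a : divides a a.
Proof. by exists 1; rewrite mul1r. Qed.

Lemma unit_neq0 (u : R) : u \is a GRing.unit -> u != 0.
Proof. by apply: contraTneq => ->; rewrite unitr0. Qed.

Lemma prime_divides_unit p u : prime_elt p -> u \is a GRing.unit -> ~ divides p u.
Proof.
by move=> [_ pU _] uU [c e]; case/negP: pU; move: uU; rewrite e unitrM => /andP[].
Qed.

Lemma cancel_prime p a u (ps : seq R) :
  prime_elt p -> u \is a GRing.unit -> (forall q, q \in ps -> prime_elt q) ->
  p * a = u * \prod_(q <- ps) q ->
  exists u' (qs : seq R), [/\ (size qs < size ps)%N, u' \is a GRing.unit,
    forall q, q \in qs -> prime_elt q & a = u' * \prod_(q <- qs) q].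
Proof.
move=> pp; have [p0 pU pP] := pp.
elim: ps a u => [|q ps IH] a u uU hps.
  rewrite big_nil mulr1 => e; case: (prime_divides_unit pp uU).
  by exists a; rewrite -e mulrC.
rewrite big_cons => e.
have pq : prime_elt q by apply: hps; rewrite inE eqxx.
have hps' r : r \in ps -> prime_elt r by move=> h; apply: hps; rewrite inE h orbT.
have [q0 qU qP] := pq.
have [] : divides p q \/ divides p (u * \prod_(q <- ps) q).
    by apply: pP; exists a; rewrite mulrCA -e mulrC.
- move=> [v qE].
  (* As [q] is prime and [q = v * p], it divides [v] or [p]; the former would make [p] a unit. *)
  have vU : v \is a GRing.unit.
    have [] : divides q v \/ divides q p by apply: qP; exists 1; rewrite mul1r.
    + move=> [w vE]; case/negP: pU; apply/unitrPr; exists w.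
      suff: w * p = 1 by move=> h; rewrite mulrC h.
      apply: (mulfI q0); rewrite mulr1 [RHS]qE [in RHS]vE; ring.
    + move=> [w pE]; apply/unitrPr; exists w.
      suff: w * v = 1 by move=> h; rewrite mulrC h.
      apply: (mulfI q0); rewrite mulr1 [RHS]qE [in RHS]pE; ring.
  exists (u * v), ps; split => //; first by rewrite unitrM uU.
  apply: (mulfI p0); rewrite e qE; ring.
- move=> [c cE].
  have [u' [qs [s1 u'U hqs cE']]] := IH c u uU hps' (etrans (mulrC _ _) (esym cE)).
  exists u', (q :: qs); split => //.
    by move=> r; rewrite inE => /predU1P[->|/hqs].
  apply: (mulfI p0); rewrite e big_cons mulrCA cE cE'; ring.
Qed.

End Ufd.

(** * Gauss's lemma and unique factorisation in [{poly R}] *)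

Section Gauss.
Variable R : idomainType.
Implicit Types (p r : R) (f g h w : {poly R}).

Lemma divides_polyC p f : divides p%:P f <-> forall i, divides p f`_i.
Proof.
split=> [[g ->] i|h].
  by exists g`_i; rewrite coefMC.
have [c cE] := boolp.choice h.
exists (\poly_(i < size f) c i); apply/polyP => i; rewrite coefMC coef_poly.
by case: ltnP => [_|/(nth_default 0) ->]; [exact: cE | rewrite mul0r].
Qed.

(** The leading coefficients multiply, so [p] divides one of them; removing that leading term keeps
    the product divisible and lowers the sum of the sizes. *)
Lemma prime_polyC p : prime_elt p -> prime_elt p%:P.
Proof.
move=> [p0 pU pP]; split; first by rewrite polyC_eq0.
  by rewrite poly_unitE size_polyC p0 coefC.
move=> f g; move: {2}(_ + _)%N (leqnn (size f + size g)) => m.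
elim: m f g => [|m IH] f g.
  rewrite leqn0 addn_eq0 size_poly_eq0 => /andP[/eqP -> _] _.
  by left; apply: divides0.
have [-> _ _|f0] := eqVneq f 0; first by left; apply: divides0.
have [-> _ _|g0] := eqVneq g 0; first by right; apply: divides0.
move=> hm hd.
have szlow h : h != 0 -> (size (h - lead_coef h *: 'X^((size h).-1))%R < size h)%N.
  move=> h0; have hs : (0 < size h)%N by rewrite size_poly_gt0.
  rewrite -[X in (_ <= X)%N](prednK hs) ltnS; apply/leq_sizeP => j hj.
  rewrite coefB coefZ coefXn; move: hj; rewrite leq_eqVlt => /predU1P[<-|hj].
    by rewrite eqxx mulr1 subrr.
  rewrite gtn_eqF // mulr0 subr0 nth_default // -(prednK hs) //.
have low h : divides p (lead_coef h) -> divides p%:P (lead_coef h *: 'X^((size h).-1)).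
  by move=> [c ->]; exists (c *: 'X^((size h).-1)); rewrite -mul_polyC polyCM -mul_polyC; ring.
have : divides p (lead_coef f * lead_coef g).
  by rewrite -lead_coefM; exact: (proj1 (divides_polyC p (f * g)) hd).
case/pP => /low hl.
- have [] := IH (f - lead_coef f *: 'X^((size f).-1)) g.
  + by rewrite -ltnS; apply: leq_trans hm; rewrite ltn_add2r szlow.
  + by rewrite mulrBl; apply: dividesB => //; apply: divides_mulr.
  + by move=> h; left; rewrite -(subrK (lead_coef f *: 'X^((size f).-1)) f); apply: dividesD.
  + by right.
- have [] := IH f (g - lead_coef g *: 'X^((size g).-1)).
  + by rewrite -ltnS; apply: leq_trans hm; rewrite ltn_add2l szlow.
  + by rewrite mulrBr; apply: dividesB => //; apply: divides_mull.
  + by left.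
  + by move=> h; right; rewrite -(subrK (lead_coef g *: 'X^((size g).-1)) g); apply: dividesD.
Qed.

Definition primitive f := forall p, prime_elt p -> ~ divides p%:P f.

Hypothesis ufdR : ufd R.

(** Divisibility over the fraction field descends to [R] when the divisor is primitive: each prime
    of [r] divides [w * f], hence [w], and is cancelled there. *)
Lemma primitive_cancel f w h r : primitive f -> r != 0 ->
  r *: h = w * f -> divides f h.
Proof.
move=> pf /ufdR [u [ps [uU hps ->]]].
elim: ps hps w => [|p ps IH] hps w.
  rewrite big_nil mulr1 => e; exists (u^-1 *: w).
  by rewrite -scalerAl -e scalerA mulVr // scale1r.
rewrite big_cons => e.
have pp : prime_elt p by apply: hps; rewrite inE eqxx.
have [_ _ pP] := prime_polyC pp.
have [|[w' wE]|/pf] // := pP w f.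
  exists ((u * \prod_(q <- ps) q) *: h).
  by rewrite -e -!mul_polyC !polyCM; ring.
apply: (IH _ w'); first by move=> q hq; apply: hps; rewrite inE hq orbT.
have [p0 _ _] := prime_polyC pp.
apply: (mulfI p0); move: e; rewrite wE -!mul_polyC !polyCM => e.
by rewrite mulrA [RHS]mulrA [p%:P * w']mulrC -e; ring.
Qed.

(** Brings a factorisation over the fraction field back to [R]: each prime of [r] divides one of the
    two factors and is cancelled there, which does not affect sizes. *)
Lemma scale_factor f g h r : r != 0 -> r *: f = g * h ->
  exists g' h', [/\ f = g' * h', size g' = size g & size h' = size h].
Proof.
move=> /ufdR [u [ps [uU hps ->]]].
elim: ps hps g h => [|p ps IH] hps g h.
  rewrite big_nil mulr1 => e; exists (u^-1 *: g), h; split => //.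
    by rewrite -scalerAl -e scalerA mulVr // scale1r.
  by rewrite size_scale // unit_neq0 // unitrV.
rewrite big_cons => e.
have pp : prime_elt p by apply: hps; rewrite inE eqxx.
have [p0 _ pP] := prime_polyC pp.
have p0' : p != 0 by case: pp.
have hps' q : q \in ps -> prime_elt q by move=> hq; apply: hps; rewrite inE hq orbT.
have [|[g' gE]|[h' hE]] // := pP g h.
- by exists ((u * \prod_(q <- ps) q) *: f); rewrite -e -!mul_polyC !polyCM; ring.
- have [|g1 [h1 [-> s1 s2]]] := IH hps' g' h.
    by apply: (mulfI p0); rewrite mulrCA mulrA -gE -e -!mul_polyC !polyCM; ring.
  by exists g1, h1; split => //; rewrite s1 gE mulrC mul_polyC size_scale.
- have [|g1 [h1 [-> s1 s2]]] := IH hps' g h'.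
    by apply: (mulfI p0); rewrite mulrCA [p%:P * h']mulrC -hE -e -!mul_polyC !polyCM; ring.
  by exists g1, h1; split => //; rewrite s2 hE mulrC mul_polyC size_scale.
Qed.

(** Every extraction of a common prime of the coefficients removes a prime from the leading
    coefficient, so the length of a factorisation of the latter bounds the number of extractions. *)
Lemma primitive_part f : f != 0 ->
  exists c f0, [/\ c != 0, primitive f0 & f = c *: f0].
Proof.
move=> f0; have /ufdR [u [ps [uU hps]]] : lead_coef f != 0 by rewrite lead_coef_eq0.
move: {2}(size ps) (leqnn (size ps)) => m.
elim: m f f0 u ps uU hps => [|m IH] f f0 u ps uU hps sz e;
  (have [pf|] := pselect (primitive f); first by exists 1, f; rewrite scale1r oner_neq0);
  move=> /existsNP [p] /not_implyP [pp] /contrapT [g fE];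
  (have [p0 _ _] := pp);
  (have lE : p * lead_coef g = u * \prod_(q <- ps) q
     by rewrite -e fE lead_coefM lead_coefC mulrC);
  have [u' [qs [s1 u'U hqs lE']]] := cancel_prime pp uU hps lE.
  by move: sz; rewrite leqNgt (leq_ltn_trans _ s1).
have g0 : g != 0 by apply: contraNneq f0 => g0; rewrite fE g0 mul0r.
have [c [h [c0 hp gE]]] := IH g g0 u' qs u'U hqs (leq_trans s1 sz) lE'.
exists (p * c), h; split => //; first by rewrite mulf_neq0.
by rewrite fE gE mulrC mul_polyC scalerA.
Qed.

(** The Euclidean argument over the fraction field, done with pseudo-division: up to scalars the
    ideal [(f, a)] is generated by one [g]. A constant [g] gives that [f] divides [b], a nonconstant
    one that [f] divides [a]. *)
Lemma irreducible_prime f : primitive f -> (1 < size f)%N ->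
  (forall g h, f = g * h -> size g = 1%N \/ size h = 1%N) -> prime_elt f.
Proof.
move=> pf s1 irr.
have f0 : f != 0 by rewrite -size_poly_gt0 ltnW.
split=> //; first by rewrite poly_unitE gtn_eqF.
move=> a b [w abE].
(* [g] has least size among the nonzero elements of the ideal [(f, a)]. *)
pose S n := `[< exists u v, u * f + v * a != 0 /\ size (u * f + v * a) = n >].
have exS : exists n, S n.
  by exists (size f); apply/asboolP; exists 1, 0; rewrite mul1r mul0r addr0.
case: (ex_minnP exS) => m /asboolP [u [v [g0 sg]]] min {exS}.
set g := u * f + v * a in g0 sg.
(* The pseudo-remainder modulo [g] stays in the ideal and is smaller than [g], so it is zero. *)
have red u' v' : exists c q, c != 0 /\ c *: (u' * f + v' * a) = q * g.
  set h := u' * f + v' * a.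
  have eq := @Pdiv.Idomain.divp_eq R h g; set c := (_ ^+ _) in eq.
  have c0 : c != 0 by rewrite expf_neq0 // lead_coef_eq0.
  exists c, (h %/ g); split => //.
  suff h0 : h %% g = 0 by rewrite h0 addr0 in eq.
  apply/eqP/negPn/negP => r0.
  have : (m <= size (h %% g)%R)%N.
    apply: min; apply/asboolP; exists (c%:P * u' - h %/ g * u), (c%:P * v' - h %/ g * v).
    suff -> : (c%:P * u' - h %/ g * u) * f + (c%:P * v' - h %/ g * v) * a = h %% g by [].
    have -> : h %% g = c%:P * h - h %/ g * g by rewrite mul_polyC eq addrC addKr.
    by rewrite /h /g; ring.
  by rewrite -sg leqNgt Pdiv.Idomain.ltn_modpN0.
have [c [q [c0 fE]]] := red 1 0; rewrite mul1r mul0r addr0 in fE.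
have [c' [q' [c'0 aE]]] := red 0 1; rewrite mul0r mul1r add0r in aE.
have [sz1|gt1] := leqP (size g) 1.
  have gE := size1_polyC sz1; set r := g`_0 in gE.
  right; apply: (@primitive_cancel _ (u * b + v * w) _ r) => //.
    by move: g0; rewrite gE polyC_eq0.
  rewrite -mul_polyC -gE /g mulrDl -[v * a * b]mulrA abE; ring.
(* Here [g] is not constant, so irreducibility of [f] makes the cofactor [q] a constant, and [f]
   divides a scalar multiple of [a]. *)
left; have [g1 [h1 [fE' sg1 sh1]]] := scale_factor c0 fE.
have [|hh] := irr _ _ fE'; last by rewrite -sh1 hh in gt1.
rewrite sg1 => szq.
have qE := size1_polyC (eq_leq szq); set k := q`_0 in qE.
have k0 : k != 0 by move: szq; rewrite qE size_polyC; case: eqP.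
apply: (@primitive_cancel _ (c *: q') _ (k * c')) => //; first by rewrite mulf_neq0.
by rewrite -scalerA aE -scalerAl [RHS]scalerAr fE qE -!mul_polyC; ring.
Qed.

Lemma ufd_poly : ufd {poly R}.
Proof.
have base (c : R) : c != 0 -> exists (u : {poly R}) (ps : seq {poly R}),
    [/\ u \is a GRing.unit, forall q : {poly R}, q \in ps -> prime_elt q
      & c%:P = u * \prod_(q <- ps) q].
  move=> /ufdR [u [ps [uU hps ->]]]; exists u%:P, [seq p%:P | p <- ps]; split.
  - by rewrite poly_unitE size_polyC coefC eqxx uU unit_neq0.
  - by move=> _ /mapP [q hq ->]; apply/prime_polyC/hps.
  - by rewrite polyCM rmorph_prod /= big_map.
have step (c : R) f : c != 0 -> (exists (u : {poly R}) (ps : seq {poly R}),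
    [/\ u \is a GRing.unit, forall q : {poly R}, q \in ps -> prime_elt q
      & f = u * \prod_(q <- ps) q]) -> exists (u : {poly R}) (ps : seq {poly R}),
    [/\ u \is a GRing.unit, forall q : {poly R}, q \in ps -> prime_elt q
      & c *: f = u * \prod_(q <- ps) q].
  move=> /base [u [ps [uU hps cE]]] [u' [qs [u'U hqs ->]]].
  exists (u * u'), (ps ++ qs); split; first by rewrite unitrM uU.
    by move=> q; rewrite mem_cat => /orP[/hps|/hqs].
  by rewrite -mul_polyC cE big_cat /=; ring.
move=> f f0; move: {2}(size f) (leqnn (size f)) => m.
elim: m f f0 => [|m IH] f f0.
  by rewrite leqn0 size_poly_eq0 (negPf f0).
move=> szf; have [c [g [c0 pg fE]]] := primitive_part f0.
have sg : size g = size f by rewrite fE size_scale.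
have g0 : g != 0 by rewrite -size_poly_gt0 sg size_poly_gt0.
rewrite fE; apply: step => //.
have [sz1|gt1] := leqP (size g) 1.
  rewrite (size1_polyC sz1); apply: base.
  by apply: contraNneq g0 => h; rewrite (size1_polyC sz1) h.
have [irr|] := pselect (forall a b, g = a * b -> size a = 1%N \/ size b = 1%N).
  exists 1, [:: g]; split; rewrite ?unitr1 ?big_seq1 ?mul1r //.
  by move=> q; rewrite inE => /eqP ->; apply: irreducible_prime.
move=> /existsNP [a] /existsNP [b] /not_implyP [gE] /not_orP [sa sb].
have a0 : a != 0 by apply: contraNneq g0 => h; rewrite gE h mul0r.
have b0 : b != 0 by apply: contraNneq g0 => h; rewrite gE h mulr0.
have := size_mul a0 b0; rewrite -gE => sab.
have sa0 : (0 < size a)%N by rewrite size_poly_gt0.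
have sb0 : (0 < size b)%N by rewrite size_poly_gt0.
have [|u [ps [uU hps aE]]] := IH a a0; first by lia.
have [|u' [qs [u'U hqs bE]]] := IH b b0; first by lia.
exists (u * u'), (ps ++ qs); split; first by rewrite unitrM uU.
  by move=> q; rewrite mem_cat => /orP[/hps|/hqs].
by rewrite gE aE bE big_cat /=; ring.
Qed.

End Gauss.

Lemma ufd_iso (R S : idomainType) (f : {rmorphism R -> S}) (g : {rmorphism S -> R}) :
  cancel f g -> cancel g f -> ufd S -> ufd R.
Proof.
move=> fK gK ufdS a a0.
have [|u [ps [uU hps faE]]] := ufdS (f a).
  by rewrite -(inj_eq (can_inj gK)) fK rmorph0.
exists (g u), [seq g p | p <- ps]; split.
- exact: rmorph_unit.
- move=> _ /mapP [p /hps [p0 pU pP] ->]; split.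
  + by rewrite -(inj_eq (can_inj fK)) gK rmorph0.
  + by apply: contra pU => /(rmorph_unit f); rewrite gK.
  + move=> x y [c e]; have [|[d xE]|[d yE]] := pP (f x) (f y).
    * by exists (f c); rewrite -rmorphM e rmorphM /= gK.
    * by left; exists (g d); rewrite -rmorphM -xE fK.
    * by right; exists (g d); rewrite -rmorphM -yE fK.
- by rewrite big_map -rmorph_prod -rmorphM -faE fK.
Qed.

(** * Unique factorisation in [{mpoly K[n]}], one variable at a time *)

Section MpolyUfd.
Variable K : fieldType.

Lemma mpolyC_unit n (c : K) : c != 0 -> (c%:MP_[n]) \is a GRing.unit.
Proof. by move=> c0; apply: rmorph_unit; rewrite unitfE. Qed.

Section Step.
Variable n : nat.

Lemma muni_mwiden (p : {mpoly K[n]}) : muni (mwiden p) = p%:P.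
Proof.
elim/mpolyind: p => [|c m p _ _ IH]; first by rewrite !raddf0.
rewrite mwidenD muniD IH polyCD mwidenZ muniZ; congr (_ + _).
rewrite mwidenX muniE msuppX big_seq1 mcoeffX eqxx scale1r mnmwiden_ordmax.
rewrite expr0 alg_polyC -mul_mpolyC polyCM mul_polyC; congr (_ *: _%:P).
by congr 'X_[_]; apply/mnmP => i; rewrite mnmE mnmwiden_widen.
Qed.

Lemma muni_ordmax : muni 'X_ord_max = 'X :> {poly {mpoly K[n]}}.
Proof.
rewrite muniE msuppX big_seq1 mcoeffX eqxx scale1r mnm1E eqxx expr1.
rewrite (_ : [multinom _ | _ < n] = 0%MM) ?mpolyX0 ?scale1r //.
apply/mnmP => i; rewrite mnmE mnm1E mnm0E; case: eqP => // /(congr1 val) /= e.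
by have := ltn_ord i; rewrite -e ltnn.
Qed.

Let comm_ordmax : commr_rmorph (@mwiden n K) 'X_ord_max.
Proof. by move=> x; apply: mulrC. Qed.

(** The inverse of [muni]: the last variable is substituted for ['X]. *)
Let hmw : {rmorphism {poly {mpoly K[n]}} -> {mpoly K[n.+1]}} := horner_morph comm_ordmax.

Let hmwC p : hmw p%:P = mwiden p.
Proof. exact: horner_morphC. Qed.

Let hmwX : hmw 'X = 'X_ord_max.
Proof. exact: horner_morphX. Qed.

Lemma horner_mwidenK : cancel hmw (@muni n K).
Proof.
elim/poly_ind => [|p c IH]; first by rewrite !raddf0.
rewrite rmorphD rmorphM hmwX hmwC.
by rewrite muniD muniM muni_mwiden muni_ordmax IH.
Qed.

Lemma muniK : cancel (@muni n K) hmw.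
Proof.
move=> p; elim/mpolyind: p => [|c m p _ _ IH]; first by rewrite !raddf0.
rewrite muniD rmorphD [X in _ + X]IH.
rewrite muniZ.
rewrite -mul_polyC.
rewrite rmorphM.
rewrite hmwC.
rewrite mwidenC.
rewrite mul_mpolyC.
suff -> : hmw (muni 'X_[m]) = 'X_[m] by [].
rewrite muniE msuppX big_seq1 mcoeffX eqxx scale1r.
rewrite -mul_polyC rmorphM hmwC rmorphXn hmwX.
rewrite mwidenX mpolyXn -mpolyXD; congr 'X_[_]; apply/mnmP => i.
rewrite mnmDE mulmnE mnm1E eq_sym.
have [->|ni] := eqVneq i ord_max; first by rewrite mnmwiden_ordmax mul1n.
have hi : (i < n)%N.
  by rewrite ltn_neqAle -ltnS ltn_ord andbT; apply: contraNneq ni => e; apply/eqP/val_inj.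
have -> : i = widen_ord (leqnSn n) (Ordinal hi) by apply: val_inj.
by rewrite mnmwiden_widen mnmE mul0n addn0.
Qed.

Lemma ufd_mpolyS : ufd {mpoly K[n]} -> ufd {mpoly K[n.+1]}.
Proof. by move=> h; apply: (ufd_iso muniK horner_mwidenK); apply: ufd_poly. Qed.

End Step.

Lemma ufd_mpoly n : ufd {mpoly K[n]}.
Proof.
elim: n => [|n IH]; last exact: ufd_mpolyS.
move=> a a0; exists a, [::]; split => //; last by rewrite big_nil mulr1.
rewrite -(mpolyKC a) mpolyC_unit //.
by apply: contraNneq a0 => h; rewrite -(mpolyKC a) h.
Qed.

End MpolyUfd.

(** * Order of a polynomial at zero *)

Section Xadic.
Variable R : idomainType.
Implicit Types p q : {poly R}.

Lemma Xadic_factor p : p != 0 -> exists i q, p = q * 'X^i /\ q`_0 != 0.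
Proof.
elim/poly_ind: p => [|p c IH]; first by rewrite eqxx.
have [->|c0] := eqVneq c 0; last first.
  by exists 0%N, (p * 'X + c%:P); rewrite expr0 mulr1 coefD coefMX coefC add0r.
rewrite addr0 => pX; have [|i [q [-> q0]]] := IH.
  by apply: contraNneq pX => ->; rewrite mul0r.
by exists i.+1, q; rewrite exprSr mulrA.
Qed.

Lemma Xn_dvd_cancel p q r m : q`_0 != 0 -> q * p = r * 'X^m -> exists s, p = s * 'X^m.
Proof.
move=> q0; elim: m p r => [|m IH] p r; first by exists p; rewrite expr0 mulr1.
move=> e; have p0 : p`_0 = 0.
  have : (q * p)`_0 = 0 by rewrite e exprSr mulrA coefMX.
  by rewrite coef0M => /eqP; rewrite mulf_eq0 (negPf q0) => /eqP.
have [p' pE] : exists p', p = p' * 'X.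
  have : root p 0 by rewrite rootE horner_coef0 p0.
  by move=> /factor_theorem [p' ->]; exists p'; rewrite subr0.
have [|s sE] := IH p' r.
  by apply: (mulIf (monic_neq0 (monicX R))); rewrite -!mulrA -exprSr -pE.
by exists s; rewrite pE sE exprSr mulrA.
Qed.

End Xadic.

(** * Factors of homogeneous polynomials *)

Section Homogeneous.
Variables (K : fieldType) (n : nat).
Implicit Types f g : {mpoly K[n]}.

(* Scaling all the variables by 'X turns homogeneity into divisibility. *)
Definition grade f : {poly {mpoly K[n]}} :=
  mmap (polyC \o @mpolyC n K) (fun i => 'X_i *: 'X) f.

Lemma gradeM f g : grade (f * g) = grade f * grade g.
Proof. exact: rmorphM. Qed.

Lemma grade_mon (m : 'X_{1..n}) : grade 'X_[m] = 'X_[m] *: 'X^(mdeg m).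
Proof.
rewrite /grade mmapX /mmap1 mdegE expr_sum -mul_polyC [X in X%:P]mpolyXE_id.
rewrite rmorph_prod /= -big_split /=.
by apply: eq_bigr => i _; rewrite -mul_polyC exprMn rmorphXn.
Qed.

Lemma coef_grade f d : (grade f)`_d = pihomog mdeg d f.
Proof.
elim/mpolyind: f => [|c m p _ _ IH]; first by rewrite /grade !raddf0 coef0.
rewrite /grade raddfD /= -/(grade p) coefD [X in _ + X]IH pihomogD; congr (_ + _).
rewrite linearZ /= pihomogX mmapZ -/(grade _) grade_mon coefCM coefZ coefXn eq_sym.
by rewrite mul_mpolyC; case: eqP => _; rewrite ?mulr1 ?mulr0.
Qed.

Lemma grade_homog f d : f \is d.-homog -> grade f = f *: 'X^d.
Proof.
move=> fd; apply/polyP => k; rewrite coef_grade coefZ coefXn.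
have [->|dk] := eqVneq k d; first by rewrite mulr1 pihomog_dE.
by rewrite mulr0 (pihomog_ne0 _ fd) // eq_sym.
Qed.

(** [grade] of the product is a constant times ['X^d]. Once the powers of ['X] are split off, the
    remaining factors have a constant product, hence are constant, so [grade f] is a single term in
    ['X]. *)
Lemma homog_mul_inv f g d : f * g \is d.-homog -> f * g != 0 ->
  exists e, (e <= d)%N /\ f \is e.-homog.
Proof.
move=> fgd fg0.
have gr0 h : h != 0 -> grade h != 0.
  apply: contraNneq => e; rewrite (pihomog_partitionE (leqnn (msize h))).
  by rewrite big1 // => i _; rewrite -coef_grade e coef0.
move: (fg0); rewrite mulf_eq0 negb_or => /andP[f0 g0].
have [i [p [fE p0]]] := Xadic_factor (gr0 f f0).
have [j [q [gE q0]]] := Xadic_factor (gr0 g g0).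
have eq : p * q * 'X^(i + j) = (f * g)%:P * 'X^d.
  by rewrite mul_polyC -(grade_homog fgd) gradeM fE gE exprD; ring.
have ijd : (i + j = d)%N.
  case: (ltngtP (i + j) d) => // h.
  - have : (p * q * 'X^(i + j))`_(i + j) = 0 by rewrite eq coefMXn h.
    rewrite coefMXn ltnn subnn coef0M => /eqP; rewrite mulf_eq0.
    by rewrite (negPf p0) (negPf q0).
  - have : ((f * g)%:P * 'X^d)`_d = 0 by rewrite -eq coefMXn h.
    by rewrite coefMXn ltnn subnn coefC => /eqP; rewrite (negPf fg0).
exists i; split; first by rewrite -ijd leq_addr.
have pqE : p * q = (f * g)%:P.
  by apply: (mulIf (monic_neq0 (monicXn _ d))); rewrite -eq ijd.
have pC : p = (p`_0)%:P.
  have p_neq0 : p != 0 by apply: contraNneq p0 => ->; rewrite coef0.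
  have q_neq0 : q != 0 by apply: contraNneq q0 => ->; rewrite coef0.
  apply: size1_polyC; have := size_mul p_neq0 q_neq0.
  rewrite pqE size_polyC fg0; move: q_neq0; rewrite -size_poly_gt0.
  by move: (size p) (size q) => x y; lia.
have cE k : (grade f)`_k = p`_0 * (k == i)%:R by rewrite fE {1}pC coefCM coefXn.
have [hi|hi] := ltnP i (msize f); last first.
  case/eqP: f0; rewrite (pihomog_partitionE (leqnn (msize f))) big1 // => k _.
  by rewrite -coef_grade cE (ltn_eqF (leq_trans (ltn_ord k) hi)) mulr0.
rewrite homog_piE; apply/eqP; rewrite [RHS](pihomog_partitionE (leqnn (msize f))).
rewrite (bigD1 (Ordinal hi)) //= big1 ?addr0 // => k ki.
rewrite -coef_grade cE (_ : (k == i :> nat) = false) ?mulr0 //.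
by apply: contraNF ki.
Qed.

Lemma divides_homog f g d : g \is d.-homog -> g != 0 -> divides f g ->
  exists e, (e <= d)%N /\ f \is e.-homog.
Proof. by move=> gd g0 [h gE]; apply: (@homog_mul_inv f h); rewrite mulrC -gE. Qed.

Lemma pihomogM f g d : pihomog mdeg d (f * g) =
  \sum_(k < d.+1) pihomog mdeg k f * pihomog mdeg (d - k) g.
Proof.
rewrite -coef_grade gradeM coefM.
apply: eq_bigr => k _.
by congr (_ * _); apply: coef_grade.
Qed.

(** The alternative between applying Bezout and removing a common component. If no prime of [g]
    divides [f], each of these primes divides [x] and can be cancelled from both sides. *)
Lemma coprime_or_common_prime f g : g != 0 ->
  (forall x y, x * f = y * g -> divides g x) \/
  (exists p, [/\ prime_elt p, divides p f & divides p g]).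
Proof.
move=> g0; have [|H] := pselect (exists p, [/\ prime_elt p, divides p f & divides p g]).
  by right.
left=> x y; have [u [ps [uU hps gE]]] := ufd_mpoly g0.
have npf p : p \in ps -> ~ divides p f.
  move=> hp pf; apply: H; exists p; split => //; first exact: hps.
  rewrite gE; apply: divides_mull; rewrite (big_rem p hp) /=.
  by apply: divides_mulr; apply: divides_refl.
rewrite {g0 H}gE; elim: ps hps npf x y => [|p ps IH] hps npf x y e.
  by exists (x * u^-1); rewrite big_nil mulr1 divrK.
move: e; rewrite big_cons => e.
have ip : p \in p :: ps by rewrite inE eqxx.
have [p0 _ pP] := hps p ip.
have [|[x' xE]|pf] := pP x f; last by case: (npf p ip).
  by exists (y * (u * \prod_(q <- ps) q)); rewrite e; ring.
have hps' q : q \in ps -> prime_elt q by move=> hq; apply: hps; rewrite inE hq orbT.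
have npf' q : q \in ps -> ~ divides q f by move=> hq; apply: npf; rewrite inE hq orbT.
have [|c cE] := IH hps' npf' x' y.
  by apply: (mulfI p0); move: e; rewrite xE => e; rewrite mulrA [p * x']mulrC e; ring.
by exists c; rewrite xE cE; ring.
Qed.

End Homogeneous.

(** * Multiplicities at a point *)

Section HomogInd.
Variables (K : fieldType) (n : nat).
Implicit Types f g : {mpoly K[n]}.

(** Reduces a statement on forms to monomials, which are built one variable at a time; the degree is
    an argument of [Q] because it changes at each step. *)
Lemma homog_ind (Q : nat -> {mpoly K[n]} -> Prop) :
  (forall d, Q d 0) -> (forall d f g, Q d f -> Q d g -> Q d (f + g)) ->
  (forall d c f, Q d f -> Q d (c *: f)) -> Q 0 1 ->
  (forall d i f, f \is d.-homog -> Q d f -> Q d.+1 ('X_i * f)) ->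
  forall d f, f \is d.-homog -> Q d f.
Proof.
move=> Q0 QD QZ Q1 QX d f /dhomogP fd; rewrite (mpolyE f) big_seq.
elim/big_ind: _ => [//|//|m /fd md]; first exact: QD.
have {md} <- : mdeg m = d by []; apply: QZ.
move: {2}(mdeg m) (erefl (mdeg m)) => e; elim: e m {fd} => [|e IH] m.
  by move/eqP; rewrite mdeg_eq0 => /eqP ->; rewrite mdeg0 mpolyX0.
move=> me; have [i mi] : exists i, (0 < m i)%N.
  apply/existsP; apply: contraTT isT => /existsPn h.
  by move: me; rewrite mdegE big1 // => i _; apply/eqP; rewrite -leqn0 leqNgt h.
have mE : m = (U_(i) + (m - U_(i)))%MM.
  by rewrite addmC submK //; apply/mnm_lepP => j; rewrite mnm1E; case: eqP => // <-.
have de : mdeg (m - U_(i))%MM = e.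
  by move: me; rewrite {1}mE mdegD mdeg1 => -[].
rewrite me mE mpolyXD; apply: QX; last by rewrite -de; apply: IH.
by rewrite dhomogX; apply/eqP.
Qed.

Lemma dhomogXU i : ('X_i : {mpoly K[n]}) \is 1.-homog.
Proof. by rewrite dhomogX; apply/eqP; apply: mdeg1. Qed.

Lemma dhomogM_eq d e k f g : f \is d.-homog -> g \is e.-homog -> (d + e = k)%N ->
  f * g \is k.-homog.
Proof. by move=> hf hg <-; apply: dhomogM. Qed.

Lemma dhomogXn f k : f \is 1.-homog -> f ^+ k \is k.-homog.
Proof. by move=> /(dhomogMn k); rewrite mul1n. Qed.

Lemma homogS_split d f : f \is d.+1.-homog ->
  exists g : 'I_n -> {mpoly K[n]},
    (forall i, g i \is d.-homog) /\ f = \sum_i 'X_i * g i.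
Proof.
move: {1 3}d.+1 (erefl d.+1) => d' e fd'; move: d e.
elim/homog_ind: fd' => {d' f} [d' d _|d' f g IHf IHg d e|d' c f IHf d e|//|d' i f fd _ d [e]].
- by exists (fun=> 0); split=> [i|]; rewrite ?dhomog0 // big1 // => i _; rewrite mulr0.
- have [g1 [h1 ->]] := IHf d e; have [g2 [h2 ->]] := IHg d e.
  exists (fun i => g1 i + g2 i); split=> [i|]; first by rewrite rpredD.
  by rewrite -big_split; apply: eq_bigr => i _; rewrite mulrDr.
- have [g1 [h1 ->]] := IHf d e; exists (fun i => c *: g1 i); split=> [i|].
    by rewrite rpredZ.
  by rewrite scaler_sumr; apply: eq_bigr => i _; rewrite scalerAr.
- exists (fun j => if j == i then f else 0); split=> [j|].
    by case: eqP => _; rewrite ?dhomog0 // -e.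
  by rewrite (bigD1 i) //= eqxx big1 ?addr0 // => j /negPf ->; rewrite mulr0.
Qed.

End HomogInd.

Definition i0 : 'I_3 := @Ordinal 3 0 isT.
Definition i1 : 'I_3 := @Ordinal 3 1 isT.
Definition i2 : 'I_3 := @Ordinal 3 2 isT.

Lemma I3P (i : 'I_3) : [\/ i = i0, i = i1 | i = i2].
Proof.
by case: i => [[|[|[|]]]] // h; [constructor 1|constructor 2|constructor 3]; apply: val_inj.
Qed.

Section Multiplicity.
Variable K : fieldType.
Implicit Types (f g : {mpoly K[3]}) (q r : {poly K}).

Definition affpt (a b : K) (i : 'I_3) : K := nth 0 [:: 1; a; b] i.

Section AtPoint.
Variables a b : K.

(* The substitution f(1, a + t, b + t y): the chart of the blow-up at (1 : a : b)
   in which the multiplicity of a form is its order in t. *)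
Definition blowup f : {poly {poly K}} :=
  mmap (polyC \o polyC)
    (fun i : 'I_3 => nth 0 [:: 1; a%:P%:P + 'X; b%:P%:P + 'X%:P * 'X] i) f.

HB.instance Definition _ := GRing.RMorphism.copy blowup
  (mmap (polyC \o polyC)
    (fun i : 'I_3 => nth 0 [:: 1; a%:P%:P + 'X; b%:P%:P + 'X%:P * 'X] i)).

(** For a form, this says that its multiplicity at [(1 : a : b)] is at least [m]. *)
Definition vge m f := exists q : {poly {poly K}}, blowup f = q * 'X^m.

Definition lu : {mpoly K[3]} := 'X_i1 - a *: 'X_i0.
Definition lv : {mpoly K[3]} := 'X_i2 - b *: 'X_i0.

Lemma blowupZ c f : blowup (c *: f) = c%:P%:P * blowup f.
Proof. exact: mmapZ. Qed.

Lemma blowupX i : blowup 'X_i = nth 0 [:: 1; a%:P%:P + 'X; b%:P%:P + 'X%:P * 'X] i.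
Proof. by rewrite /blowup mmapX mmap1U. Qed.

Lemma blowup_u : blowup lu = 'X.
Proof. by rewrite rmorphB /= blowupZ !blowupX /= mulr1 addrC addKr. Qed.

Lemma blowup_v : blowup lv = 'X%:P * 'X.
Proof. by rewrite rmorphB /= blowupZ !blowupX /= mulr1 addrC addKr. Qed.

Lemma lu_homog : lu \is 1.-homog.
Proof. by rewrite rpredB ?rpredZ // dhomogXU. Qed.

Lemma lv_homog : lv \is 1.-homog.
Proof. by rewrite rpredB ?rpredZ // dhomogXU. Qed.

Lemma coef0_blowup f : (blowup f)`_0 = (f.@[affpt a b])%:P.
Proof.
rewrite -horner_coef0 /blowup /mmap horner_sum /meval /mmap rmorph_sum /=.
apply: eq_bigr => m _; rewrite hornerM hornerC polyCM; congr (_ * _).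
rewrite /mmap1 horner_prod rmorph_prod; apply: eq_bigr => i _ /=.
rewrite horner_exp rmorphXn; congr (_ ^+ _).
by case: (I3P i) => ->; rewrite /affpt /= ?hornerE ?mulr0 ?addr0.
Qed.

Lemma vgeP m f : vge m f <-> forall k, (k < m)%N -> (blowup f)`_k = 0.
Proof.
split=> [[g ->] k km|h]; first by rewrite coefMXn km.
exists (\poly_(k < size (blowup f)) (blowup f)`_(k + m)); apply/polyP => k.
rewrite coefMXn coef_poly; case: ltnP => [/h //|mk].
case: ltnP => [_|hk]; first by rewrite subnK.
by rewrite nth_default // (leq_trans hk) // leq_subr.
Qed.

Lemma vge1P f : vge 1 f <-> f.@[affpt a b] = 0.
Proof.
rewrite vgeP; split=> [/(_ 0%N isT)|h [|//] _]; last by rewrite coef0_blowup h.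
by rewrite coef0_blowup => /eqP; rewrite polyC_eq0 => /eqP.
Qed.

Lemma vge_0 f : vge 0 f.
Proof. by exists (blowup f); rewrite expr0 mulr1. Qed.

Lemma vge0 m : vge m 0.
Proof. by exists 0; rewrite /blowup raddf0 mul0r. Qed.

Lemma vgeD m f g : vge m f -> vge m g -> vge m (f + g).
Proof. by move=> [x fE] [y gE]; exists (x + y); rewrite rmorphD /= fE gE mulrDl. Qed.

Lemma vgeM m k f g : vge m f -> vge k g -> vge (m + k) (f * g).
Proof. by move=> [x fE] [y gE]; exists (x * y); rewrite rmorphM /= fE gE exprD; ring. Qed.

Lemma vgeMl m f g : vge m f -> vge m (g * f).
Proof. by move=> h; rewrite -[m]add0n; apply: vgeM => //; apply: vge_0. Qed.

Lemma vgeMr m f g : vge m f -> vge m (f * g).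
Proof. by rewrite mulrC; apply: vgeMl. Qed.

Lemma vgeZ m c f : vge m f -> vge m (c *: f).
Proof. by rewrite -mul_mpolyC; apply: vgeMl. Qed.

Lemma vgeB m f g : vge m f -> vge m g -> vge m (f - g).
Proof. by move=> hf hg; apply: vgeD => //; rewrite -scaleN1r; apply: vgeZ. Qed.

Lemma vge_sum (I : Type) (r : seq I) (Q : pred I) (F : I -> {mpoly K[3]}) m :
  (forall i, Q i -> vge m (F i)) -> vge m (\sum_(i <- r | Q i) F i).
Proof. by move=> h; elim/big_ind: _ => //; [exact: vge0 | exact: vgeD]. Qed.

Lemma vge_le m k f : (k <= m)%N -> vge m f -> vge k f.
Proof. by move=> km [g e]; exists (g * 'X^(m - k)); rewrite e -mulrA -exprD subnK. Qed.

Lemma vgeX m k f : vge m f -> vge (k * m) (f ^+ k).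
Proof.
move=> h; elim: k => [|k IH]; first by rewrite expr0; apply: vge_0.
by rewrite mulSn exprS; apply: vgeM.
Qed.

Lemma vge_u : vge 1 lu.
Proof. by exists 1; rewrite blowup_u mul1r. Qed.

Lemma vge_v : vge 1 lv.
Proof. by exists 'X%:P; rewrite blowup_v. Qed.

(** Orders in [t] add up, since lowest coefficients have a nonzero product; the second hypothesis
    bounds the order of [g] by [j]. *)
Lemma vge_cancel m j f g : vge m (g * f) -> ~ vge j.+1 g -> vge (m - j) f.
Proof.
move=> [r rE] hg; have g0 : blowup g != 0.
  by apply/eqP => e; apply: hg; exists 0; rewrite e mul0r.
have [i [q [qE q0]]] := Xadic_factor g0.
have ij : (i <= j)%N.
  rewrite leqNgt; apply/negP => ij; apply: hg.
  by apply: (@vge_le i) => //; exists q.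
have [mi|im] := leqP m i.
  by rewrite (eqP (leq_trans mi ij : m - j == 0)%N); apply: vge_0.
have [|s sE] := @Xn_dvd_cancel _ (blowup f) q r (m - i) q0.
  apply: (mulIf (monic_neq0 (monicXn _ i))).
  by rewrite -[RHS]mulrA -exprD subnK ?(ltnW im) // -rE rmorphM /= qE; ring.
by apply: (@vge_le (m - i)); [rewrite leq_sub2l | exists s].
Qed.

(** The binary form [u^k q(v/u)] in the local coordinates [u = lu], [v = lv]. For [q] of degree at
    most [k], [blowup] turns it into [q] times the [k]-th power of [t]. *)
Definition binform k q : {mpoly K[3]} :=
  \sum_(j < k.+1) q`_j *: (lu ^+ (k - j) * lv ^+ j).

Lemma binform_homog k q : binform k q \is k.-homog.
Proof.
rewrite rpred_sum // => j _; rewrite rpredZ //.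
apply: dhomogM_eq (subnK (leq_ord j)); apply: dhomogXn.
  exact: lu_homog.
exact: lv_homog.
Qed.

Lemma binformD k q r : binform k (q + r) = binform k q + binform k r.
Proof. by rewrite -big_split; apply: eq_bigr => j _; rewrite coefD scalerDl. Qed.

Lemma binformZ k c q : binform k (c *: q) = c *: binform k q.
Proof. by rewrite scaler_sumr; apply: eq_bigr => j _; rewrite coefZ scalerA. Qed.

Lemma binform0 k : binform k 0 = 0.
Proof. by rewrite /binform big1 // => j _; rewrite coef0 scale0r. Qed.

Lemma binform_u k q : (size q <= k.+1)%N -> binform k.+1 q = lu * binform k q.
Proof.
move=> sq; rewrite /binform big_ord_recr /= [q`_k.+1]nth_default // scale0r addr0.
rewrite mulr_sumr; apply: eq_bigr => j _.
by rewrite subSn ?leq_ord // exprS -scalerAr mulrA.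
Qed.

Lemma binform_v k q : binform k.+1 (q * 'X) = lv * binform k q.
Proof.
rewrite /binform big_ord_recl /= coefMX eqxx scale0r add0r mulr_sumr.
apply: eq_bigr => j _; rewrite coefMX /= /bump /= add1n subSS exprS -scalerAr.
by congr (_ *: _); ring.
Qed.

Lemma blowup_binform k q : (size q <= k.+1)%N -> blowup (binform k q) = q%:P * 'X^k.
Proof.
elim: k q => [|k IH] q sq.
  rewrite /binform big_ord_recl big_ord0 addr0 subnn !expr0 mulr1 [in RHS](size1_polyC sq).
  by rewrite blowupZ rmorph1.
have -> : q = (q`_0)%:P + (\poly_(j < k.+1) q`_j.+1) * 'X.
  apply/polyP => -[|j]; rewrite coefD coefC coefMX /= ?addr0 //.
  rewrite add0r coef_poly; case: ltnP => // hj; apply: nth_default.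
  by apply: leq_trans sq _; rewrite ltnS.
rewrite binformD rmorphD /= binform_v rmorphM /= IH ?size_poly // binform_u.
  rewrite rmorphM /= IH ?(leq_trans (size_polyC_leq1 _)) // blowup_u blowup_v.
  by rewrite polyCD polyCM exprS; ring.
exact: leq_trans (size_polyC_leq1 _) _.
Qed.

(** Such expansions are stable under multiplication by [x0], [lu] and [lv], which span the linear
    forms. *)
Lemma taylor_ex d f : f \is d.-homog -> exists c : nat -> {poly K},
  (forall k, (size (c k) <= k.+1)%N) /\
  f = \sum_(k < d.+1) 'X_i0 ^+ (d - k) * binform k (c k).
Proof.
pose Q d f := exists c : nat -> {poly K}, (forall k, (size (c k) <= k.+1)%N) /\
  f = \sum_(k < d.+1) 'X_i0 ^+ (d - k) * binform k (c k).
have Q0 e : Q e 0.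
  by exists (fun=> 0); split=> [k|]; rewrite ?size_poly0 // big1 // => k _; rewrite binform0 mulr0.
have QD e f1 f2 : Q e f1 -> Q e f2 -> Q e (f1 + f2).
  move=> [c [hc ->]] [c' [hc' ->]]; exists (fun k => c k + c' k); split=> [k|].
    by apply: leq_trans (size_polyD _ _) _; rewrite geq_max hc hc'.
  by rewrite -big_split; apply: eq_bigr => k _; rewrite binformD mulrDr.
have QZ e x f1 : Q e f1 -> Q e (x *: f1).
  move=> [c [hc ->]]; exists (fun k => x *: c k); split=> [k|].
    exact: leq_trans (size_scale_leq _ _) (hc k).
  by rewrite scaler_sumr; apply: eq_bigr => k _; rewrite binformZ scalerAr.
have QX0 e f1 : Q e f1 -> Q e.+1 ('X_i0 * f1).
  move=> [c [hc ->]]; exists (fun k => if (k <= e)%N then c k else 0); split=> [k|].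
    by case: ifP; rewrite ?size_poly0.
  rewrite [RHS]big_ord_recr /= ltnn binform0 mulr0 addr0 mulr_sumr.
  by apply: eq_bigr => k _; rewrite leq_ord subSn ?leq_ord // exprS mulrA.
have Qu e f1 : Q e f1 -> Q e.+1 (lu * f1).
  move=> [c [hc ->]]; exists (fun k => if k is k'.+1 then c k' else 0); split=> [[|k]|].
  - by rewrite size_poly0.
  - exact: leq_trans (hc k) _.
  rewrite [RHS]big_ord_recl /= binform0 mulr0 add0r mulr_sumr.
  by apply: eq_bigr => k _; rewrite binform_u // subSS; ring.
have Qv e f1 : Q e f1 -> Q e.+1 (lv * f1).
  move=> [c [hc ->]]; exists (fun k => if k is k'.+1 then c k' * 'X else 0); split=> [[|k]|].
  - by rewrite size_poly0.
  - have [->|ck] := eqVneq (c k) 0; first by rewrite mul0r size_poly0.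
    by rewrite size_mulX ?ltnS.
  rewrite [RHS]big_ord_recl /= binform0 mulr0 add0r mulr_sumr.
  by apply: eq_bigr => k _; rewrite binform_v subSS; ring.
move=> fd; apply: (homog_ind Q0 QD QZ _ _ fd) => {d f fd} [|d i f _ hf].
  exists (fun=> 1); split=> [k|]; first by rewrite size_poly1.
  rewrite big_ord_recl big_ord0 addr0 subnn expr0 mul1r /binform.
  by rewrite big_ord_recl big_ord0 addr0 subnn !expr0 mulr1 coefC eqxx scale1r.
case: (I3P i) => ->; first exact: QX0.
- have -> : 'X_i1 = lu + a *: 'X_i0 by rewrite subrK.
  by rewrite mulrDl -scalerAl; apply: QD; [exact: Qu | apply/QZ/QX0].
- have -> : 'X_i2 = lv + b *: 'X_i0 by rewrite subrK.
  by rewrite mulrDl -scalerAl; apply: QD; [exact: Qv | apply/QZ/QX0].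
Qed.

(** Taylor expansion at the point: the coefficient of the [k]-th power of [t] is the part of order
    [k], dehomogenised. *)
Lemma taylor d f : f \is d.-homog ->
  [/\ forall k, (size ((blowup f)`_k)%R <= k.+1)%N,
      forall k, (d < k)%N -> (blowup f)`_k = 0
    & f = \sum_(k < d.+1) 'X_i0 ^+ (d - k) * binform k (blowup f)`_k].
Proof.
move=> fd; have [c [hc fE]] := taylor_ex fd.
have bE : blowup f = \poly_(k < d.+1) c k.
  rewrite {1}fE rmorph_sum /= poly_def; apply: eq_bigr => k _.
  by rewrite rmorphM rmorphXn /= blowupX expr1n mul1r blowup_binform // mul_polyC.
have bk k : (k < d.+1)%N -> (blowup f)`_k = c k by move=> h; rewrite bE coef_poly h.
split=> [k|k dk|].
- by rewrite bE coef_poly; case: ifP; rewrite ?size_poly0.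
- by rewrite bE coef_poly ltnS leqNgt dk.
- by rewrite [LHS]fE; apply: eq_bigr => k _; rewrite bk.
Qed.

Lemma blowup_eq0 d f : f \is d.-homog -> blowup f = 0 -> f = 0.
Proof.
move=> fd e; have [_ _ ->] := taylor fd.
by rewrite big1 // => k _; rewrite e coef0 binform0 mulr0.
Qed.

Lemma vge_deg d m f : f \is d.-homog -> vge m f -> (d < m)%N -> f = 0.
Proof.
move=> fd /vgeP h dm; apply: (blowup_eq0 fd); apply/polyP => k; rewrite coef0.
have [km|mk] := ltnP k m; first exact: h.
by have [_ -> //] := taylor fd; apply: leq_trans dm mk.
Qed.

(** One step of the passage from multiplicity to powers of the ideal of the point: in each Taylor
    term the constant coefficient contributes a multiple of [lu], the rest a multiple of [lv]. *)
Lemma vgeS_split d m f : f \is d.+1.-homog -> vge m.+1 f ->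
  exists f1 f2, [/\ f1 \is d.-homog, f2 \is d.-homog, vge m f1, vge m f2
    & f = lu * f1 + lv * f2].
Proof.
move=> fd /vgeP hm; have [sz _ fE] := taylor fd.
pose c k := (blowup f)`_k.+1.
pose c2 k := \poly_(j < k.+1) (c k)`_j.+1.
have cE k : c k = ((c k)`_0)%:P + c2 k * 'X.
  apply/polyP => -[|j]; rewrite coefD coefC coefMX /= ?addr0 //.
  rewrite add0r coef_poly; case: ltnP => // hj; apply: nth_default.
  by apply: leq_trans (sz k.+1) _; rewrite ltnS.
have hd (c' : nat -> {poly K}) : \sum_(k < d.+1) 'X_i0 ^+ (d - k) * binform k (c' k) \is d.-homog.
  rewrite rpred_sum // => k _; apply: dhomogM_eq (subnK (leq_ord k)).
    by apply: dhomogXn; apply: dhomogXU.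
  exact: binform_homog.
have hv (c' : nat -> {poly K}) : (forall k, (size (c' k) <= k.+1)%N) ->
    (forall k, (k < m)%N -> c' k = 0) ->
    vge m (\sum_(k < d.+1) 'X_i0 ^+ (d - k) * binform k (c' k)).
  move=> hs h0; apply: vge_sum => k _; apply: vgeMl.
  have [km|mk] := ltnP k m; first by rewrite h0 // binform0; apply: vge0.
  by apply: (@vge_le k) => //; exists (c' k)%:P; rewrite blowup_binform.
have c0 k : (k < m)%N -> c k = 0 by move=> km; apply: hm.
exists (\sum_(k < d.+1) 'X_i0 ^+ (d - k) * binform k ((c k)`_0)%:P).
exists (\sum_(k < d.+1) 'X_i0 ^+ (d - k) * binform k (c2 k)).
split.
- exact: (hd (fun k => ((c k)`_0)%:P)).
- exact: hd.
- apply: (hv (fun k => ((c k)`_0)%:P)) => k; first exact: leq_trans (size_polyC_leq1 _) _.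
  by move=> /c0 ->; rewrite coef0.
- apply: hv => k; first exact: size_poly.
  by move=> /c0 e; apply/polyP => j; rewrite coef_poly e !coef0 if_same.
rewrite fE big_ord_recl hm // binform0 mulr0 add0r !mulr_sumr -big_split.
apply: eq_bigr => k _; rewrite /= /bump /= add1n subSS -/(c k) {1}cE binformD.
rewrite binform_v binform_u; last exact: leq_trans (size_polyC_leq1 _) _.
ring.
Qed.

End AtPoint.
End Multiplicity.

(** * Bezout's inequality *)

Lemma hom_of_linear (K : fieldType) (aT rT : vectType K) (f : aT -> rT) :
  linear f -> exists phi : 'Hom(aT, rT), forall x, phi x = f x.
Proof.
move=> lf; pose F : {linear aT -> rT} := HB.pack f (GRing.isLinear.Build _ _ _ _ f lf).
by exists (linfun F) => x; rewrite lfunE.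
Qed.

Lemma dim_row (K : fieldType) D : \dim {: 'rV[K]_D} = D.
Proof. by rewrite dimvf dim_matrix; apply: mul1n. Qed.

Lemma tri_bin d : ('C(d + 2, d) * 2 = d.+2 * d.+1)%N.
Proof.
rewrite -bin_sub ?leq_addr // addKn addn2.
by have := bin_ffact d.+2 2; rewrite !ffactnS ffactn0 muln1.
Qed.

Section Forms.
Variable K : fieldType.
Local Notation form d := (dhomog 3 K d).

Lemma dim_forms d : \dim {: form d} = 'C(d + 2, d).
Proof. by rewrite dimvf. Qed.

Lemma mul_hom (f : {mpoly K[3]}) d e k : f \is d.-homog -> (d + e = k)%N ->
  exists phi : 'Hom(form e, form k), forall g, val (phi g) = f * val g.
Proof.
move=> fd dek; have h (g : form e) : f * val g \is k.-homog.
  exact: dhomogM_eq fd (dhomog_is_dhomog g) dek.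
have [|phi E] := @hom_of_linear _ _ _ (fun g => DHomog (h g) : form k).
  by move=> c x y; apply: val_inj => /=; rewrite mulrDr scalerAr.
by exists phi => g; rewrite E.
Qed.

Lemma mul_hom_ker0 (f : {mpoly K[3]}) e k (phi : 'Hom(form e, form k)) : f != 0 ->
  (forall g, val (phi g) = f * val g) -> lker phi = 0%VS.
Proof.
move=> f0 E; apply/eqP; rewrite -subv0; apply/subvP => g.
rewrite memv_ker memv0 => /eqP /(congr1 val) /eqP; rewrite E /= mulf_eq0 (negPf f0) /=.
by move=> /eqP h; apply/eqP/val_inj.
Qed.

Lemma mul_hom_dim (f : {mpoly K[3]}) e k (phi : 'Hom(form e, form k)) U : f != 0 ->
  (forall g, val (phi g) = f * val g) -> \dim (phi @: U) = \dim U.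
Proof. by move=> f0 /mul_hom_ker0 h; apply: limg_dim_eq; rewrite h // capv0. Qed.

End Forms.

(** * Conditions imposed by multiple points *)

Section FatPoints.
Variables (K : fieldType) (n : nat) (a b : 'I_n -> K).
Local Notation form d := (dhomog 3 K d).
Implicit Types k : 'I_n -> nat.

(** One index per Taylor coefficient of order less than [k i] at the [i]-th point; the part of order
    [x] has [x + 1] coefficients. *)
Definition jets k := {i : 'I_n & {x : 'I_(k i) & 'I_x.+1}}.

Lemma card_jets k : #|{: jets k}| = (\sum_i 'C((k i).+1, 2))%N.
Proof.
rewrite card_tagged sumnE big_map big_enum /=; apply: eq_bigr => i _.
rewrite card_tagged sumnE big_map big_enum /= -bin2_sum big_mkord.
by rewrite big_ord_recl add0n; apply: eq_bigr => x _; rewrite card_ord.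
Qed.

Definition jetpoly k (r : 'rV[K]_#|{: jets k}|) i (x : 'I_(k i)) : {poly K} :=
  \poly_(y < x.+1) r 0 (enum_rank (Tagged (fun i => {x : 'I_(k i) & 'I_x.+1})
    (Tagged (fun x : 'I_(k i) => 'I_x.+1) (i := x) (inord y)) : jets k)).

Lemma codim_fat k e : exists U : {vspace (form e)},
  (forall f, f \in U -> forall i, vge (a i) (b i) (k i) (val f)) /\
  ('C(e + 2, e) <= \dim U + \sum_i 'C((k i).+1, 2))%N.
Proof.
pose jet (w : jets k) (f : {mpoly K[3]}) : K :=
  ((blowup (a (tag w)) (b (tag w)) f)`_(tag (tagged w)))`_(tagged (tagged w)).
pose F (f : form e) : 'rV[K]_#|{: jets k}| := \row_w jet (enum_val w) (val f).
have [|phi E] := @hom_of_linear _ _ _ F.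
  move=> c f g; apply/rowP => w; rewrite !mxE /jet /= rmorphD /= blowupZ !coefD.
  by rewrite !coefCM.
exists (lker phi); split=> [f|]; last first.
  rewrite -card_jets -(dim_forms K e) -(limg_ker_dim phi) capfv leq_add2l.
  apply: leq_trans (dimvS (subvf _)) _.
  by rewrite dim_row.
rewrite memv_ker E => /eqP /rowP f0 i; apply/vgeP => x xk.
have [sz _ _] := taylor (a i) (b i) (dhomog_is_dhomog f).
apply/polyP => y; rewrite coef0.
have [yx|xy] := ltnP y x.+1; last by rewrite nth_default // (leq_trans (sz x)).
pose w : jets k := Tagged (fun i => {x : 'I_(k i) & 'I_x.+1})
  (Tagged (fun x : 'I_(k i) => 'I_x.+1) (i := Ordinal xk) (Ordinal yx)).
by have := f0 (enum_rank w); rewrite !mxE enum_rankK.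
Qed.

Hypothesis distinct : forall i j, i != j -> (a i, b i) != (a j, b j).

(** A product of linear forms, one through each other point and not through the [i]-th; [x0], which
    vanishes at none of the points, stands in for [j = i] and makes the degree exactly [n]. *)
Lemma separator i : exists f : {mpoly K[3]}, [/\ f \is n.-homog,
  ~ vge (a i) (b i) 1 f & forall j, j != i -> vge (a j) (b j) 1 f].
Proof.
pose l j := if j == i then 'X_i0 else if a i != a j then lu (a j) else lv (b j).
have lh j : l j \is 1.-homog.
  by rewrite /l; do !case: ifP => _; rewrite ?dhomogXU ?lu_homog ?lv_homog.
have l0 j : j != i -> (l j).@[affpt (a j) (b j)] = 0.
  move=> ji; apply/(vge1P _ _ _); rewrite /l (negPf ji).
  by case: ifP => _; [exact: vge_u | exact: vge_v].
have li j : (l j).@[affpt (a i) (b i)] != 0.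
  rewrite /l; case: (j =P i) => [_|/eqP ji]; first by rewrite mevalXU oner_eq0.
  have := distinct ji; rewrite xpair_eqE negb_and.
  case: (boolP (a i != a j)) => [aij _|/negbNE/eqP ->].
    by rewrite mevalB mevalZ !mevalXU /affpt /= mulr1 subr_eq0.
  by rewrite eqxx /= mevalB mevalZ !mevalXU /affpt /= mulr1 subr_eq0 eq_sym.
exists (\prod_j l j); split.
- have -> : \prod_j l j = \prod_(x <- [tuple l j | j < n]) x.
    by rewrite big_map big_enum.
  have := @dhomog_prod _ _ mdeg n [tuple 1%N | j < n] [tuple l j | j < n].
  rewrite [(\sum_(i <- [tuple 1%N | _ < n]) i)%N]big_map big_enum sum1_card card_ord; apply=> j.
  by rewrite !tnth_mktuple.
- by move=> /vge1P; rewrite rmorph_prod => /eqP/prodf_eq0 [j _]; apply/negP/li.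
- by move=> j ji; apply/vge1P; rewrite rmorph_prod (bigD1 j) //= l0 // mul0r.
Qed.

(** In large degree the conditions are independent: an explicit family of forms, one for each choice
    of jets, meets any space of forms satisfying the conditions only in zero. *)
Lemma codim_fat_ge k : exists e0, forall e (U : {vspace (form e)}), (e0 <= e)%N ->
  (forall f, f \in U -> forall i, vge (a i) (b i) (k i) (val f)) ->
  (\dim U + \sum_i 'C((k i).+1, 2) <= 'C(e + 2, e))%N.
Proof.
have [s hs] := boolp.choice separator.
pose M := (\max_i k i)%N.
have kM i : (k i <= M)%N by apply: leq_bigmax.
(* [s i ^+ M] has degree [n * M] and order at least [M] at the other points; the second [M] keeps
   the truncated subtraction [e - n * M - x] exact. *)
exists (n * M + M)%N => e U he hU.
pose G r := \sum_i s i ^+ M * \sum_(x < k i) 'X_i0 ^+ (e - n * M - x) *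
  binform (a i) (b i) x (jetpoly r x).
have Gh r : G r \is e.-homog.
  rewrite rpred_sum // => i _; have [si _ _] := hs i.
  apply: (@dhomogM_eq _ _ (n * M) (e - n * M)); first exact: dhomogMn.
    rewrite rpred_sum // => x _; apply: (@dhomogM_eq _ _ (e - n * M - x) x).
    - by apply: dhomogXn; apply: dhomogXU.
    - exact: binform_homog.
    - have := kM i; have := ltn_ord x; lia.
  by lia.
have [|phi E] := @hom_of_linear _ _ _ (fun r => DHomog (Gh r) : form e).
  move=> c r r'; apply: val_inj => /=; rewrite /G scaler_sumr -big_split /=.
  apply: eq_bigr => i _; rewrite scalerAr -mulrDr scaler_sumr -big_split /=.
  congr (_ * _); apply: eq_bigr => x _; rewrite scalerAr -mulrDr -binformZ -binformD.
  congr (_ * binform _ _ _ _); apply/polyP => y.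
  rewrite coefD coefZ !coef_poly; case: ifP => _; last by rewrite mulr0 addr0.
  by rewrite !mxE.
have G0 r : (forall i, vge (a i) (b i) (k i) (G r)) -> r = 0.
  move=> hG; have c0 i (x : 'I_(k i)) : jetpoly r x = 0.
    have [_ si _] := hs i.
    (* The other summands have order at least [k i] here and [s i] is nonzero at the point, so [A]
       has order at least [k i]; its coefficients below that order are the jets in [r]. *)
    set A := \sum_(x < k i) 'X_i0 ^+ (e - n * M - x) * binform (a i) (b i) x (jetpoly r x).
    have hA : vge (a i) (b i) (k i) A.
      rewrite -[k i]subn0; apply: (@vge_cancel _ _ _ _ 0 _ (s i ^+ M)).
        have := hG i; rewrite /G (bigD1 i) //= => h.
        rewrite -[X in vge _ _ _ X](addrK (\sum_(j | j != i) s j ^+ M *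
          \sum_(x < k j) 'X_i0 ^+ (e - n * M - x) * binform (a j) (b j) x (jetpoly r x))).
        apply: vgeB => //; apply: vge_sum => j ji; apply: vgeMr.
        have [_ _ /(_ i) sj] := hs j.
        apply: (@vge_le _ _ _ (M * 1)); first by rewrite muln1.
        by apply: vgeX; apply: sj; rewrite eq_sym.
      move=> /vge1P; rewrite rmorphXn => /eqP; rewrite expf_eq0 => /andP[_ /eqP h].
      by apply: si; apply/vge1P.
    have bA : blowup (a i) (b i) A = \poly_(y < k i)
        (if (insub y : option (ordinal (k i))) is Some x then jetpoly r x else 0).
      rewrite /A rmorph_sum poly_def /=; apply: eq_bigr => y _.
      rewrite rmorphM rmorphXn /= blowupX expr1n mul1r blowup_binform ?size_poly //.
      by rewrite mul_polyC valK.
    move: hA => /vgeP /(_ x (ltn_ord x)); rewrite bA coef_poly ltn_ord.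
    by rewrite valK.
  apply/rowP => w; rewrite mxE -[w]enum_valK; case: (enum_val w) => i [x y].
  have := congr1 (fun p : {poly K} => p`_y) (c0 i x); rewrite coef_poly coef0 ltn_ord.
  by rewrite inord_val.
have ker0 : lker phi = 0%VS.
  apply/eqP; rewrite -subv0; apply/subvP => r; rewrite memv_ker memv0 E => /eqP h.
  apply/eqP/G0 => i; have /= -> := congr1 val h; exact: vge0.
have cap0 : (U :&: limg phi)%VS = 0%VS.
  apply/eqP; rewrite -subv0; apply/subvP => f; rewrite memv_cap => /andP[fU /memv_imgP [r _ fE]].
  rewrite memv0 fE; apply/eqP; suff -> : r = 0 by rewrite linear0.
  by apply: G0 => i; have := hU _ fU i; rewrite fE E.
rewrite -card_jets -(dim_forms K e) -[#|_|](dim_row K).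
rewrite -(@limg_dim_eq _ _ _ phi) ?ker0 ?capv0 //.
by rewrite -(dimv_disjoint_sum cap0) dimvS ?subvf.
Qed.

(** A dimension count in a large degree [t + e + d]. Let [R_k] be the forms of degree [k] and [Z] a
    space of forms of degree [e + t] with multiplicity [m i - 1] at the points of [S]. All of
    [f R_(e+d) + g Z] has multiplicity [m i] there, and the two summands meet inside [f g R_e]. In
    the comparison of dimensions the binomials leave [t * d] on one side and the sum of the [m i] on
    the other. *)
Lemma bezout (S : {pred 'I_n}) (m : 'I_n -> nat) t d (f g : {mpoly K[3]}) :
  f \is t.-homog -> g \is d.-homog -> f != 0 -> g != 0 ->
  (forall x y, x * f = y * g -> divides g x) ->
  (forall i, vge (a i) (b i) (m i) f) -> {in S, forall i, vge (a i) (b i) 1 g} ->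
  (\sum_(i in S) m i <= t * d)%N.
Proof.
move=> ft gd f0 g0 cop hf hg.
(* Outside [S] no condition is imposed, as [g] may miss those points. *)
pose k i := if i \in S then m i else 0%N.
have [e he] := codim_fat_ge k.
have [Z [hZ dZ]] := codim_fat (fun i => (k i).-1) (e + t).
have [pf Ef] := mul_hom ft (erefl (t + (e + d))%N).
have dk : (d + (e + t) = t + (e + d))%N by lia.
have [pg Eg] := mul_hom gd dk.
have ek : (d + t + e = t + (e + d))%N by lia.
have [pfg Efg] := mul_hom (dhomogM gd ft) ek.
have U1 := he _ (limg pf + pg @: Z)%VS.
have cap : (limg pf :&: pg @: Z <= limg pfg)%VS.
  apply/subvP => h; rewrite memv_cap => /andP[/memv_imgP [x _ hx] /memv_imgP [y _ hy]].
  have xy : val x * f = val y * g by rewrite mulrC -Ef -hx hy Eg mulrC.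
  have [w wE] := cop _ _ xy.
  have [->|h0] := eqVneq h 0; first exact: mem0v.
  have hE : val h = (g * f) * w by rewrite hx Ef wE; ring.
  have h0' : val h != 0 by apply: contraNneq h0 => h0; apply/eqP/val_inj.
  have [c [_ wc]] : exists c, (c <= t + (e + d))%N /\ w \is c.-homog.
    apply: (@homog_mul_inv _ _ w (g * f)); rewrite mulrC -hE //.
    exact: dhomog_is_dhomog.
  have cE : c = e.
    have := dhomog_uniq h0' (dhomog_is_dhomog h).
    rewrite hE => /(_ _ (dhomogM (dhomogM gd ft) wc)); lia.
  rewrite cE in wc; apply/memv_imgP; exists (DHomog wc); first exact: memvf.
  by apply: val_inj; rewrite Efg /= hE.
have gf0 : g * f != 0 by rewrite mulf_neq0.
have := dimv_sum_cap (limg pf) (pg @: Z).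
rewrite (mul_hom_dim _ f0 Ef) (mul_hom_dim _ g0 Eg) dim_forms => dims.
have := dimvS cap; rewrite (mul_hom_dim _ gf0 Efg) dim_forms => dcap.
have {U1} : (\dim (limg pf + pg @: Z) + \sum_i 'C((k i).+1, 2) <= 'C(t + (e + d) + 2, t + (e + d)))%N.
  apply: U1; first by lia.
  move=> h /memv_addP [_ /memv_imgP [x _ ->] [_ /memv_imgP [y yZ ->] ->]] i.
  apply: vgeD.
    rewrite /= Ef; apply: vgeMr; rewrite /k; case: ifP => _ //; exact: vge_0.
  rewrite /= Eg; rewrite /k; case: ifP => [iS|_]; last exact: vge_0.
  have := hZ y yZ i; rewrite /k iS; case: (m i) => [_|mi h1]; first exact: vge_0.
  by rewrite -[mi.+1]add1n; apply: vgeM => //; apply: hg.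
have sumE : (\sum_i 'C((k i).+1, 2) = \sum_i 'C((k i).-1.+1, 2) + \sum_(i in S) m i)%N.
  rewrite [(\sum_(i in S) m i)%N]big_mkcond -big_split /=; apply: eq_bigr => i _.
  by rewrite /k; case: ifP => _ //; case: (m i) => // x; rewrite binS bin1.
rewrite sumE; move: dims dZ dcap; set s1 := (\sum_i _)%N; set s2 := (\sum_(i in S) _)%N.
move=> dims dZ dcap hU.
have key : ('C(t + (e + d) + 2, t + (e + d)) + 'C(e + 2, e) =
    'C(e + d + 2, e + d) + 'C(e + t + 2, e + t) + t * d)%N.
  have := tri_bin (e + t); have := tri_bin (e + d); have := tri_bin e.
  have := tri_bin (t + (e + d)).
  move: 'C(_, _) 'C(_, _) 'C(_, _) 'C(_, _) => c1 c2 c3 c4 h1 h2 h3 h4.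
  apply/eqP; rewrite -(eqn_pmul2r (isT : 0 < 2)%N) !mulnDl h1 h2 h3 h4; apply/eqP; ring.
move: dims dZ dcap hU key.
move: 'C(_, _) 'C(_, _) 'C(_, _) 'C(_, _) (t * d)%N => c1 c2 c3 c4 c5.
move: s1 s2 (\dim (limg pf + _)) (\dim (limg pf :&: _)) (\dim Z) => s1 s2 D1 D2 D3.
lia.
Qed.

End FatPoints.

(** * Curves that meet every curve nonnegatively *)

Section Nef.
Variables (K : fieldType) (n : nat) (a b : 'I_n -> K).
Hypothesis distinct : forall i j, i != j -> (a i, b i) != (a j, b j).

Lemma homog0_const k (p : {mpoly K[k]}) : p \is 0.-homog -> p = (p@_0)%:MP.
Proof.
move=> p0; apply/mpolyP => m; rewrite mcoeffC eq_sym.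
have [->|m0] := eqVneq m 0%MM; first by rewrite mulr1.
by rewrite mulr0 (dhomog_nemf_coeff p0) // mdeg_eq0.
Qed.

Lemma homog_divr k (f g : {mpoly K[k]}) d e :
  g * f \is d.-homog -> g * f != 0 -> f \is e.-homog ->
  (e <= d)%N /\ g \is (d - e).-homog.
Proof.
move=> gfd gf0 fe; have [c [cd gc]] := homog_mul_inv gfd gf0.
have -> := dhomog_uniq gf0 gfd (dhomogM gc fe).
by rewrite leq_addl addnK.
Qed.

Lemma prime_homog_gt0 k (p : {mpoly K[k]}) e : prime_elt p -> p \is e.-homog -> (0 < e)%N.
Proof.
move=> [p0 pU _]; rewrite lt0n => pe; apply: contraNneq pU => e0.
move: pe p0; rewrite e0 => /homog0_const ->; rewrite mpolyC_eq0.
exact: mpolyC_unit.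
Qed.

(* [C 0 + ... + C (q - 1)] meets each of its components nonnegatively, counting
   only the assigned base points; hence it meets every curve nonnegatively. *)
Lemma nef_curve q (C : 'I_q -> {mpoly K[3]}) (dd : 'I_q -> nat) (S : 'I_q -> {set 'I_n}) :
  (forall j, [/\ C j \is (dd j).-homog, C j != 0 &
     {in S j, forall i, vge (a i) (b i) 1 (C j)}]) ->
  (forall j D e, D \is e.-homog -> (0 < e)%N -> divides D (C j) ->
     exists mu : 'I_n -> nat, (forall i, ~ vge (a i) (b i) (mu i).+1 D) /\
       (\sum_k \sum_(i in S k) mu i <= e * \sum_k dd k)%N) ->
  forall t F (m : 'I_n -> nat), F \is t.-homog -> F != 0 ->
    (forall i, vge (a i) (b i) (m i) F) ->
    (\sum_k \sum_(i in S k) m i <= t * \sum_k dd k)%N.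
Proof.
move=> hC hD t; have [T] := ubnP t; elim: T t => // T IH t tT F m Ft F0 hF.
(* If [F] is coprime to every [C j], the bound is the sum of the Bezout inequalities; otherwise a
   common prime is removed and the degree of [F] drops. *)
have [cop|] := pselect (forall j x y, x * F = y * C j -> divides (C j) x).
  rewrite big_distrr; apply: leq_sum => j _; have [Cd C0 hS] := hC j.
  exact: (bezout distinct Ft Cd F0 C0 (cop j) hF hS).
move=> /existsNP [j ncop]; have [Cd C0 hS] := hC j.
have [//|[p [pp [F' FE] pC]]] := coprime_or_common_prime F C0.
have [e [_ pe]] := divides_homog Cd C0 pC.
have e0 := prime_homog_gt0 pp pe.
rewrite FE in Ft F0 hF; have [et F't] := homog_divr Ft F0 pe.
have F'0 : F' != 0 by apply: contraNneq F0 => ->; rewrite mul0r.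
(* Removing [p] lowers the multiplicity at [i] by at most [mu i], and the hypothesis on components
   bounds the total loss by what the degree [e] of [p] pays for. *)
have [mu [hmu smu]] := hD j p e pe e0 pC.
have tT' : (t - e < T)%N by lia.
have h : (\sum_k \sum_(i in S k) (m i - mu i) <= (t - e) * \sum_k dd k)%N.
  apply: (IH _ tT' F' (fun i => (m i - mu i)%N) F't F'0).
  by move=> i; apply: vge_cancel (hmu i); rewrite mulrC; apply: hF.
apply: leq_trans (_ : \sum_k \sum_(i in S k) (m i - mu i) + \sum_k \sum_(i in S k) mu i <= _)%N.
  rewrite -big_split; apply: leq_sum => k _; rewrite -big_split; apply: leq_sum => i _ /=.
  by rewrite addnC -leq_subLR.
by apply: leq_trans (leq_add h smu) _; rewrite -mulnDl subnK.
Qed.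

End Nef.

(** * Powers of the ideal of the points in high degree *)

Lemma meval_sum (K : comNzRingType) k (v : 'I_k -> K) (I : Type) (r : seq I) (Q : pred I)
    (F : I -> {mpoly K[k]}) :
  (\sum_(i <- r | Q i) F i).@[v] = \sum_(i <- r | Q i) (F i).@[v].
Proof. exact: raddf_sum. Qed.

Section AdditiveClosure.
Variable V : nmodType.
Implicit Types (A B : V -> Prop) (f g : V).

(** Finite sums of elements of [A]. Sums rather than generated ideals are used so that the degree of
    every factor stays on record. *)
Inductive addcl A : V -> Prop :=
| addcl0 : addcl A 0
| addclS f g : A f -> addcl A g -> addcl A (f + g).

Lemma addcl_gen A f : A f -> addcl A f.
Proof. by move=> h; rewrite -[f]addr0; apply: addclS => //; apply: addcl0. Qed.

Lemma addclD A f g : addcl A f -> addcl A g -> addcl A (f + g).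
Proof.
move=> hf hg; elim: hf => [|x y hx _ IH]; first by rewrite add0r.
by rewrite -addrA; apply: addclS.
Qed.

Lemma addcl_sum A (I : Type) (r : seq I) (Q : pred I) (F : I -> V) :
  (forall i, Q i -> addcl A (F i)) -> addcl A (\sum_(i <- r | Q i) F i).
Proof. by move=> h; elim/big_ind: _ => //; [exact: addcl0 | exact: addclD]. Qed.

Lemma addcl_le A B : B 0 -> (forall f g, B f -> B g -> B (f + g)) ->
  (forall f, A f -> B f) -> forall f, addcl A f -> B f.
Proof. by move=> B0 BD AB f; elim=> // x y /AB hx _; apply: BD. Qed.

End AdditiveClosure.

Lemma addcl_mull (R : pzRingType) (A B : R -> Prop) (x : R) :
  (forall f, A f -> addcl B (x * f)) -> forall f, addcl A f -> addcl B (x * f).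
Proof.
move=> h; apply: (@addcl_le _ A (fun f => addcl B (x * f))).
- by rewrite mulr0; apply: addcl0.
- by move=> f g /=; rewrite mulrDr; apply: addclD.
- exact: h.
Qed.

Section Regularity.
Variables (K : fieldType) (n s : nat) (a b : 'I_n -> K) (e : 'I_n -> {mpoly K[3]}).
Implicit Types f g h : {mpoly K[3]}.
Local Notation ev i f := (f.@[affpt (a i) (b i)]).
Local Notation X0 := ('X_i0 : {mpoly K[3]}).

Hypothesis distinct : forall i j, i != j -> (a i, b i) != (a j, b j).
Hypothesis e_homog : forall i, e i \is s.-homog.
Hypothesis e_ev : forall i j, ev j (e i) = (i == j)%:R.

Let ev_vge i f : ev i f = 0 <-> vge (a i) (b i) 1 f.
Proof. by split=> /vge1P. Qed.

Let evX0 i : ev i X0 = 1.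
Proof. by rewrite mevalXU. Qed.

Let X0h k : X0 ^+ k \is k.-homog.
Proof. by apply: dhomogXn; apply: dhomogXU. Qed.

(** [vform] is the degree [s + 1] part [V] of the ideal of the points, [vpow r] the space [V^r]
    spanned by [r]-fold products, and [videal r k] the space [R_k V^r] of forms of degree
    [r(s+1) + k]. *)
Definition vform f := f \is s.+1.-homog /\ forall i, ev i f = 0.

Fixpoint vpow r : {mpoly K[3]} -> Prop :=
  if r is r'.+1 then addcl (fun f => exists x y, [/\ vform x, vpow r' y & f = x * y])
  else fun f => exists c, f = c%:MP.

Definition videal r k := addcl (fun f => exists h y, [/\ h \is k.-homog, vpow r y & f = h * y]).

Lemma vform_mulX0 f : f \is s.-homog -> (forall i, ev i f = 0) -> vform (X0 * f).
Proof.
move=> fh f0; split=> [|i]; last by rewrite mevalM f0 mulr0.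
by apply: dhomogM_eq fh _; [exact: dhomogXU | rewrite add1n].
Qed.

Lemma vform_sep i l : l \is 1.-homog -> ev i l = 0 -> vform (l * e i).
Proof.
move=> lh l0; split=> [|j]; first by apply: dhomogM_eq lh (e_homog i) _; rewrite add1n.
rewrite mevalM e_ev; case: eqP => [<-|_]; last by rewrite mulr0.
by rewrite l0 mul0r.
Qed.

Lemma vform_vge i f : vform f -> vge (a i) (b i) 1 f.
Proof. by move=> [_ f0]; apply/ev_vge. Qed.

Lemma vpow0 r : vpow r 0.
Proof. by case: r => [|r]; [exists 0; rewrite mpolyC0 | exact: addcl0]. Qed.

Lemma vpowD r f g : vpow r f -> vpow r g -> vpow r (f + g).
Proof.
case: r => [|r]; last exact: addclD.
by move=> [c ->] [d ->]; exists (c + d); rewrite mpolyCD.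
Qed.

Lemma vpowS r x y : vform x -> vpow r y -> vpow r.+1 (x * y).
Proof. by move=> hx hy; apply: addcl_gen; exists x, y. Qed.

Lemma vpow1 f : vform f -> vpow 1 f.
Proof. by move=> hf; rewrite -[f]mulr1; apply: vpowS => //; exists 1; rewrite mpolyC1. Qed.

Lemma vpowM r k f g : vpow r f -> vpow k g -> vpow (r + k) (f * g).
Proof.
elim: r f => [f [c ->] hg|r IH f hf hg].
  rewrite add0n mul_mpolyC; case: k hg => [[d ->]|k].
    by exists (c * d); rewrite -mul_mpolyC mpolyCM.
  rewrite -mul_mpolyC; apply: addcl_mull => _ [x [y [[xh x0] hy ->]]].
  apply: addcl_gen; exists (c%:MP * x), y; split=> //; last by rewrite mulrA.
  split=> [|i]; first by rewrite mul_mpolyC rpredZ.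
  by rewrite mevalM x0 mulr0.
rewrite addSn mulrC; apply: (addcl_mull _ hf) => _ [x [y [hx hy ->]]].
by rewrite mulrCA; apply: vpowS => //; rewrite mulrC; apply: IH.
Qed.

Lemma vpowZ r c f : vpow r f -> vpow r (c *: f).
Proof. by move=> h; rewrite -mul_mpolyC -[r]add0n; apply: vpowM => //; exists c. Qed.

Lemma vpow_vge i r f : vpow r f -> vge (a i) (b i) r f.
Proof.
elim: r f => [f _|r IH f]; first exact: vge_0.
apply: (@addcl_le _ _ (fun f => vge (a i) (b i) r.+1 f)) => [|x y|_ [x [y [hx /IH yv ->]]]];
  [exact: vge0|exact: vgeD|].
by rewrite -add1n; apply: vgeM => //; apply: vform_vge.
Qed.

Lemma videal_vge i r k f : videal r k f -> vge (a i) (b i) r f.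
Proof.
apply: (@addcl_le _ _ (fun f => vge (a i) (b i) r f)) => [|x y|_ [x [y [_ hy ->]]]];
  [exact: vge0|exact: vgeD|].
by apply: vgeMl; apply: vpow_vge.
Qed.

Lemma videal_gen r k h y : h \is k.-homog -> vpow r y -> videal r k (h * y).
Proof. by move=> hh hy; apply: addcl_gen; exists h, y. Qed.

Lemma videal_mull r k l h f : h \is l.-homog -> videal r k f -> videal r (l + k) (h * f).
Proof.
move=> hh; apply: addcl_mull => _ [x [y [xh hy ->]]]; rewrite mulrA.
by apply: videal_gen => //; apply: dhomogM.
Qed.

Lemma videal_mulv r k l y f : vpow l y -> videal r k f -> videal (l + r) k (y * f).
Proof.
move=> hl; apply: addcl_mull => _ [x [z [xh hz ->]]]; rewrite mulrCA.
by apply: videal_gen => //; apply: vpowM.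
Qed.

Lemma interpolate h l : h \is (s + l).-homog ->
  (h - \sum_i ev i h *: (e i * X0 ^+ l) \is (s + l).-homog) /\
  forall j, ev j (h - \sum_i ev i h *: (e i * X0 ^+ l)) = 0.
Proof.
move=> hh; split=> [|j].
  by rewrite rpredB // rpred_sum // => i _; rewrite rpredZ // dhomogM // X0h.
rewrite mevalB meval_sum (bigD1 j) //= big1 ?addr0 => [|i ij].
  by rewrite mevalZ mevalM rmorphXn /= evX0 expr1n e_ev eqxx !mulr1 subrr.
by rewrite mevalZ mevalM e_ev (negPf ij) mul0r mulr0.
Qed.

(** Write [f] as a sum of [x_j g_j] and subtract interpolants from the [g_j]. What remains is a sum
    of terms [x0^(k+1) l_i e_i], and evaluation at the [i]-th point shows that the linear form [l_i]
    vanishes there, so that [l_i e_i] lies in [V]. *)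
Lemma vanishing_generated k f : f \is (s.+1 + k).-homog -> (forall i, ev i f = 0) ->
  videal 1 k f.
Proof.
elim: k f => [|k IH] f fh f0.
  rewrite -[f]mul1r; apply: videal_gen; first exact: dhomog1.
  by apply: vpow1; split=> //; rewrite addn0 in fh.
rewrite addnS in fh; have [g [gh fE]] := homogS_split fh.
have gh' j : g j \is (s + k.+1).-homog by rewrite addnS -addSn.
pose q j := g j - \sum_i ev i (g j) *: (e i * X0 ^+ k.+1).
have hq j : videal 1 k (q j).
  by have [qh q0] := interpolate (gh' j); apply: IH => //; rewrite addSn -addnS.
pose l i := \sum_j ev i (g j) *: 'X_j.
have lh i : l i \is 1.-homog by rewrite rpred_sum // => j _; rewrite rpredZ // dhomogXU.
have fE' : f = \sum_j 'X_j * q j + \sum_i X0 ^+ k.+1 * (l i * e i).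
  rewrite /l; under [X in _ = _ + X]eq_bigr do rewrite mulr_suml mulr_sumr.
  rewrite exchange_big -big_split fE /=; apply: eq_bigr => j _.
  rewrite /q mulrBr mulr_sumr -[LHS](subrK (\sum_i 'X_j * (ev i (g j) *: (e i * X0 ^+ k.+1)))).
  congr (_ + _); apply: eq_bigr => i _; rewrite -!mul_mpolyC; ring.
rewrite fE'; apply: addclD; apply: addcl_sum => i _.
  by rewrite -[k.+1]add1n; apply: videal_mull => //; apply: dhomogXU.
apply: videal_gen; first exact: X0h.
apply: vpow1; apply: vform_sep => //.
have := f0 i; rewrite fE' mevalD !meval_sum big1 => [|j _]; last first.
  by have [_ q0] := interpolate (gh' j); rewrite mevalM q0 mulr0.
rewrite add0r (bigD1 i) //= big1 => [|j ji]; last first.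
  by rewrite !mevalM e_ev (negPf ji) !mulr0.
by rewrite addr0 !mevalM rmorphXn /= evX0 e_ev eqxx expr1n mul1r mulr1 meval_sum.
Qed.

(** As the points differ, [x0 = x + y] with linear forms [x] through the [i]-th point and [y]
    through the [j]-th; then [l * e j], [x * e i], [l * e i] and [y * e j] all lie in [V]. *)
Lemma vpow2_line i j l : i != j -> l \is 1.-homog -> ev i l = 0 -> ev j l = 0 ->
  vpow 2 (l * e i * e j * X0).
Proof.
move=> ij lh li lj.
have [x [y [xh yh xi yj X0E]]] : exists x y : {mpoly K[3]}, [/\ x \is 1.-homog, y \is 1.-homog,
    ev i x = 0, ev j y = 0 & X0 = x + y].
  have := distinct ij; rewrite xpair_eqE negb_and => /orP[] h.
  - have h0 : a j - a i != 0 by rewrite subr_eq0 eq_sym.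
    exists ((a j - a i)^-1 *: lu (a i)), (- (a j - a i)^-1 *: lu (a j)); split.
    + by rewrite rpredZ // lu_homog.
    + by rewrite rpredZ // lu_homog.
    + by rewrite mevalZ (iffRL (ev_vge _ _) (vge_u _ _)) mulr0.
    + by rewrite mevalZ (iffRL (ev_vge _ _) (vge_u _ _)) mulr0.
    + rewrite scaleNr -scalerBr.
      have -> : lu (a i) - lu (a j) = (a j - a i) *: X0.
        by rewrite /lu scalerBl -!mul_mpolyC; ring.
      by rewrite scalerA mulVf // scale1r.
  - have h0 : b j - b i != 0 by rewrite subr_eq0 eq_sym.
    exists ((b j - b i)^-1 *: lv (b i)), (- (b j - b i)^-1 *: lv (b j)); split.
    + by rewrite rpredZ // lv_homog.
    + by rewrite rpredZ // lv_homog.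
    + by rewrite mevalZ (iffRL (ev_vge _ _) (vge_v _ _)) mulr0.
    + by rewrite mevalZ (iffRL (ev_vge _ _) (vge_v _ _)) mulr0.
    + rewrite scaleNr -scalerBr.
      have -> : lv (b i) - lv (b j) = (b j - b i) *: X0.
        by rewrite /lv scalerBl -!mul_mpolyC; ring.
      by rewrite scalerA mulVf // scale1r.
have -> : l * e i * e j * X0 = (l * e j) * (x * e i) + (l * e i) * (y * e j).
  by rewrite {1}X0E; ring.
by apply: vpowD; apply: vpowS; try apply: vpow1; apply: vform_sep.
Qed.

(** With [f = u f1 + v g1], the parts of [f1] and [g1] that vanish at all the points give products
    at once. Their interpolants give terms [l_j e_i e_j x0], where [l_j] vanishes at the [i]-th
    point and, because [f] does, at the [j]-th. *)
Lemma vpow2_double i f : vform f -> vge (a i) (b i) 2 f -> vpow 2 (f * e i * X0).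
Proof.
move=> [fh f0] f2.
have [f1 [g1 [f1h g1h /ev_vge f1i /ev_vge g1i fE]]] := vgeS_split fh f2.
have [|f1'h f1'0] := @interpolate f1 0; first by rewrite addn0.
have [|g1'h g1'0] := @interpolate g1 0; first by rewrite addn0.
set f1' := f1 - _ in f1'h f1'0; set g1' := g1 - _ in g1'h g1'0.
rewrite addn0 in f1'h g1'h.
pose l j := ev j f1 *: lu (a i) + ev j g1 *: lv (b i).
have lh j : l j \is 1.-homog by rewrite rpredD ?rpredZ ?lu_homog ?lv_homog.
have ui : ev i (lu (a i)) = 0 by apply/ev_vge/vge_u.
have vi : ev i (lv (b i)) = 0 by apply/ev_vge/vge_v.
have -> : f * e i * X0 = (lu (a i) * e i) * (X0 * f1') + (lv (b i) * e i) * (X0 * g1') +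
    \sum_j l j * e i * e j * X0.
  have -> : \sum_j l j * e i * e j * X0 = (e i * X0) *
      (lu (a i) * (\sum_j ev j f1 *: (e j * X0 ^+ 0)) + lv (b i) * (\sum_j ev j g1 *: (e j * X0 ^+ 0))).
    rewrite !mulr_sumr -big_split mulr_sumr; apply: eq_bigr => j _ /=.
    by rewrite /l expr0 mulr1 -!mul_mpolyC; ring.
  by rewrite /f1' /g1' fE; ring.
apply: vpowD; first apply: vpowD.
- by apply: vpowS; [exact: vform_sep (lu_homog _) ui | apply/vpow1/vform_mulX0].
- by apply: vpowS; [exact: vform_sep (lv_homog _) vi | apply/vpow1/vform_mulX0].
elim/big_ind: _ => [||j _]; [exact: vpow0|exact: vpowD|].
have [->|ij] := eqVneq j i.
  by rewrite /l f1i g1i !scale0r addr0 !mul0r; apply: vpow0.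
apply: vpow2_line => //; first by rewrite eq_sym.
  by rewrite /l mevalD !mevalZ ui vi !mulr0 addr0.
have := f0 j; rewrite fE mevalD !mevalM => <-.
by rewrite /l mevalD !mevalZ [_ * ev j f1]mulrC [_ * ev j g1]mulrC.
Qed.

(** The elements of [V^r] of multiplicity [r + 1] at the [i]-th point, presented by products with
    one factor singular there; for [r = 0] a constant that vanishes at the point is zero. *)
Definition vpow_double i r : {mpoly K[3]} -> Prop :=
  if r is r'.+1 then
    addcl (fun f => exists x y, [/\ vform x, vge (a i) (b i) 2 x, vpow r' y & f = x * y])
  else eq 0.

(** An element of [V] is [l * e i], with [l] its linear part at the point, up to an element of [V]
    singular there. Multiplying out leaves [e i ^+ r] times a binary form of degree [r] in [lu] and
    [lv]; the equation for [blowup g] says that [g] is such a form. *)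
Lemma vpow_leading i r f : vpow r f -> exists g q,
  [/\ g \is r.-homog, blowup (a i) (b i) g = q%:P * 'X^r & vpow_double i r (f - e i ^+ r * g)].
Proof.
elim: r f => [f [c ->]|r IH f].
  exists c%:MP, c%:P; split.
  - by rewrite -[c%:MP]mulr1 mul_mpolyC rpredZ // dhomog1.
  - by rewrite -[c%:MP]mulr1 mul_mpolyC blowupZ rmorph1 expr0.
  - by rewrite expr0 mul1r subrr.
have ui : ev i (lu (a i)) = 0 by apply/ev_vge/vge_u.
have vi : ev i (lv (b i)) = 0 by apply/ev_vge/vge_v.
pose Q f := exists g (q : {poly K}), [/\ g \is r.+1.-homog,
  blowup (a i) (b i) g = q%:P * 'X^(r.+1) & vpow_double i r.+1 (f - e i ^+ r.+1 * g)].
apply: (@addcl_le _ _ Q) => [|f1 f2 [g1 [q1 [h1 b1 d1]]] [g2 [q2 [h2 b2 d2]]]|_ [x [y [xv yv ->]]]].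
- exists 0, 0; split; [exact: dhomog0|by rewrite raddf0 mul0r|].
  by rewrite mulr0 subr0; apply: addcl0.
- exists (g1 + g2), (q1 + q2); split; [exact: rpredD| |].
    by rewrite rmorphD /= b1 b2 polyCD mulrDl.
  by rewrite mulrDr opprD addrACA; apply: addclD.
have [g [q [gh gb gd]]] := IH y yv.
have [xh x0] := xv.
have [x1 [x2 [x1h x2h _ _ xE]]] := vgeS_split xh (vform_vge i xv).
pose l := ev i x1 *: lu (a i) + ev i x2 *: lv (b i).
have lh : l \is 1.-homog by rewrite rpredD ?rpredZ ?lu_homog ?lv_homog.
have l0 : ev i l = 0 by rewrite mevalD !mevalZ ui vi !mulr0 addr0.
have lev := vform_sep lh l0.
exists (l * g), ((ev i x1)%:P * q + (ev i x2)%:P * 'X * q); split.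
- exact: dhomogM_eq lh gh _.
- rewrite rmorphM rmorphD /= !blowupZ blowup_u blowup_v gb !polyCD !polyCM exprS; ring.
have -> : x * y - e i ^+ r.+1 * (l * g) = (x - l * e i) * y + (l * e i) * (y - e i ^+ r * g).
  by rewrite exprS; ring.
apply: addclD.
  apply: addcl_gen; exists (x - l * e i), y; split=> //.
    split=> [|j]; first by rewrite rpredB //; case: lev.
    by case: lev => _ h; rewrite mevalB x0 h subr0.
  have -> : x - l * e i = lu (a i) * (x1 - ev i x1 *: e i) + lv (b i) * (x2 - ev i x2 *: e i).
    by rewrite xE /l -!mul_mpolyC; ring.
  apply: vgeD; apply: (@vgeM _ _ _ 1 1).
  - exact: vge_u.
  - by apply/ev_vge; rewrite mevalB mevalZ e_ev eqxx mulr1 subrr.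
  - exact: vge_v.
  - by apply/ev_vge; rewrite mevalB mevalZ e_ev eqxx mulr1 subrr.
case: {IH yv Q} r gh gb gd => [|r] gh gb gd.
  by rewrite -gd mulr0; apply: addcl0.
apply: (addcl_mull _ gd) => _ [z [w [zv z2 wv ->]]].
rewrite mulrCA; apply: addcl_gen; exists z, (l * e i * w); split=> //.
exact: vpowS.
Qed.

Lemma vpow_double_vge i r f : vpow_double i r f -> vge (a i) (b i) r.+1 f.
Proof.
case: r => [<-|r]; first exact: vge0.
apply: (@addcl_le _ _ (fun f => vge (a i) (b i) r.+2 f)) => [|x y|_ [x [y [_ x2 yv ->]]]];
  [exact: vge0|exact: vgeD|].
exact: (vgeM x2 (vpow_vge i yv)).
Qed.

(** Neither [e i] nor [x0] vanishes at the point, so the order condition forces the leading binary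
    form to be zero. *)
Lemma vpow_doubleP i r k f : vpow r f -> vge (a i) (b i) r.+1 (f * e i * X0 ^+ k) ->
  vpow_double i r f.
Proof.
move=> fv f2; have [g [q [gh gb gd]]] := vpow_leading i fv.
suff g0 : g = 0 by rewrite g0 mulr0 subr0 in gd.
apply: (@blowup_eq0 _ (a i) (b i) _ _ gh); rewrite gb.
have /vgeP /(_ r (ltnSn r)) : vge (a i) (b i) r.+1 g.
  rewrite -[r.+1]subn0; apply: (@vge_cancel _ _ _ _ 0 _ (e i ^+ r.+1 * X0 ^+ k)).
    have -> : e i ^+ r.+1 * X0 ^+ k * g =
        f * e i * X0 ^+ k - (f - e i ^+ r * g) * (e i * X0 ^+ k) by rewrite exprS; ring.
    by apply: vgeB => //; apply: vgeMr; apply: vpow_double_vge.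
  move=> /ev_vge; rewrite mevalM !rmorphXn /= e_ev evX0 eqxx !expr1n mulr1.
  by move/eqP; rewrite oner_eq0.
by rewrite gb coefMXn ltnn subnn coefC /= => ->; rewrite mul0r.
Qed.

(** Interpolating the cofactors of degree [s + 1 + k] splits off parts that vanish at the points and
    so contribute one more factor from [V]; only the terms in the [e i] remain. *)
Lemma videal_step r k f : videal r (s.+1 + k) f -> exists phi : 'I_n -> {mpoly K[3]},
  (forall i, vpow r (phi i)) /\ videal r.+1 k (f - \sum_i phi i * e i * X0 ^+ k.+1).
Proof.
pose Q f := exists phi : 'I_n -> {mpoly K[3]}, (forall i, vpow r (phi i)) /\
  videal r.+1 k (f - \sum_i phi i * e i * X0 ^+ k.+1).
apply: (@addcl_le _ _ Q) => [|f1 f2 [p1 [h1 d1]] [p2 [h2 d2]]|_ [h [y [hh yv ->]]]].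
- exists (fun=> 0); split=> [i|]; first exact: vpow0.
  by rewrite big1 ?subr0 => [|i _]; [exact: addcl0|rewrite !mul0r].
- exists (fun i => p1 i + p2 i); split=> [i|]; first exact: vpowD.
  under eq_bigr do rewrite !mulrDl; rewrite big_split /= opprD addrACA.
  exact: addclD.
exists (fun i => ev i h *: y); split=> [i|]; first exact: vpowZ.
rewrite addSn -addnS in hh; have [qh q0] := interpolate hh.
have -> : h * y - \sum_i (ev i h *: y) * e i * X0 ^+ k.+1 =
    y * (h - \sum_i ev i h *: (e i * X0 ^+ k.+1)).
  rewrite mulrBr [y * h]mulrC mulr_sumr; congr (_ - _); apply: eq_bigr => i _.
  by rewrite -!mul_mpolyC; ring.
rewrite -addn1; apply: videal_mulv => //; apply: vanishing_generated => //.
by rewrite addSn -addnS.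
Qed.

(* Symbolic and ordinary powers of the ideal of the points agree in degrees at least
   r times its regularity s + 1. *)
Lemma symbolic_form_generated r k f : f \is (r * s.+1 + k).-homog ->
  (forall i, vge (a i) (b i) r f) -> videal r k f.
Proof.
elim: r k f => [|r IH] k f fh fv.
  rewrite -[f]mulr1; apply: videal_gen; first by rewrite mul0n in fh.
  by exists 1; rewrite mpolyC1.
have [|phi [hphi hf]] := @videal_step r k f.
  apply: IH => [|i]; first by rewrite addnA -mulSnr.
  exact: vge_le (leqnSn r) (fv i).
rewrite -[f](subrK (\sum_i phi i * e i * X0 ^+ k.+1)); apply: addclD => //.
apply: addcl_sum => i _.
(* At the [i]-th point every other summand has multiplicity [r] from [phi j] and one more from
   [e j]; by difference the [i]-th summand has multiplicity [r + 1] there. *)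
have : vpow_double i r (phi i).
  apply: (@vpow_doubleP i r k.+1) => //.
  have -> : phi i * e i * X0 ^+ k.+1 = f - (f - \sum_i phi i * e i * X0 ^+ k.+1) -
      \sum_(j | j != i) phi j * e j * X0 ^+ k.+1.
    by rewrite subKr (bigD1 i) //= addrK.
  apply: vgeB; first by apply: vgeB => //; apply: videal_vge hf.
  apply: vge_sum => j ji; apply: vgeMr; rewrite -addn1; apply: vgeM; first exact: vpow_vge.
  by apply/ev_vge; rewrite e_ev (negPf ji).
case: {IH fh fv hf} r hphi => [|r] hphi.
  by move=> <-; rewrite !mul0r; apply: addcl0.
rewrite -mulrA mulrC; apply: addcl_mull => _ [x [y [xv x2 yv ->]]].
have -> : e i * X0 ^+ k.+1 * (x * y) = X0 ^+ k * (x * e i * X0 * y) by rewrite exprS; ring.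
apply: videal_gen; first exact: X0h.
by apply: (@vpowM 2) => //; apply: vpow2_double.
Qed.

End Regularity.

(** * General position *)

Section InfiniteField.
Variable K : fieldType.
Hypothesis K_infinite : infinite_set [set: K].

Lemma nonroot_exists (p : {poly K}) : p != 0 -> exists x, p.[x] != 0.
Proof.
move=> p0; apply: contrapT => h.
have [B _ sB] := infinite_set_fset (size p) K_infinite.
have /(max_poly_roots p0) : all (root p) (finmap.enum_fset B).
  by apply/allP => x _; apply/negPn/negP => hx; apply: h; exists x.
by move=> /(_ (finmap.fset_uniq B)); rewrite ltnNge sB.
Qed.

Lemma muni_meval k (f : {mpoly K[k.+1]}) (v : 'I_k -> K) (x : K) :
  (map_poly (meval v) (muni f)).[x] =
    f.@[fun i => if unlift ord_max i is Some j then v j else x].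
Proof.
elim/mpolyind: f => [|c m p _ _ IH].
  by rewrite muni0 rmorph0 horner0 meval0.
rewrite muniD rmorphD hornerD [X in _ + X]IH mevalD; congr (_ + _).
rewrite muniZ -mul_polyC rmorphM /= map_polyC /= mevalC hornerM hornerC mevalZ.
congr (_ * _); rewrite muniE msuppX big_seq1 mcoeffX eqxx scale1r.
rewrite -mul_polyC rmorphM /= map_polyC map_polyXn /= hornerM hornerC hornerXn.
rewrite !mevalX big_ord_recr /= unlift_none; congr (_ * _).
apply: eq_bigr => i _; rewrite mnmE; congr (_ ^+ _).
have -> : widen_ord (leqnSn k) i = lift ord_max i.
  by apply: val_inj; rewrite /= /bump leqNgt ltn_ord.
by rewrite liftK.
Qed.

Lemma nonvanishing_point k (f : {mpoly K[k]}) : f != 0 -> exists v, f.@[v] != 0.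
Proof.
elim: k f => [|k IH] f f0.
  exists (fun=> 0); rewrite -(mpolyKC f) mevalC.
  by apply: contraNneq f0 => h; rewrite -(mpolyKC f) h.
have mf0 : muni f != 0.
  by apply: contraNneq f0 => h; rewrite -(muniK f) h rmorph0.
have [|v hv] := IH (lead_coef (muni f)); first by rewrite lead_coef_eq0.
have [|x hx] := @nonroot_exists (map_poly (meval v) (muni f)).
  apply: contraNneq hv => h; have := congr1 (fun p : {poly K} => p`_(size (muni f)).-1) h.
  by rewrite coef_map coef0 => ->.
by exists (fun i => if unlift ord_max i is Some j then v j else x); rewrite -muni_meval.
Qed.

End InfiniteField.

(** * Multihomogeneous polynomials in the coordinates of the points *)

Section Multihomogeneous.
Variables (K : fieldType) (n : nat).
Implicit Types (F G : {mpoly K[n * 3]}) (dd : 'I_n -> nat).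

Lemma multihomog0 dd : multihomog dd (0 : {mpoly K[n * 3]}).
Proof. by move=> m; rewrite msupp0. Qed.

Lemma multihomogD dd F G : multihomog dd F -> multihomog dd G -> multihomog dd (F + G).
Proof. by move=> hF hG m /msuppD_le; rewrite mem_cat => /orP[/hF|/hG]. Qed.

Lemma multihomogZ dd c F : multihomog dd F -> multihomog dd (c *: F).
Proof. by move=> hF m /msuppZ_le /hF. Qed.

Lemma multihomogM d1 d2 F G : multihomog d1 F -> multihomog d2 G ->
  multihomog (fun i => d1 i + d2 i)%N (F * G).
Proof.
move=> hF hG m /msuppM_le /allpairsP [[m1 m2] /= [/hF h1 /hG h2 ->]] i.
by rewrite -h1 -h2 -big_split; apply: eq_bigr => j _; rewrite mnmDE.
Qed.

Lemma multihomog_eq d1 d2 F : multihomog d1 F -> d1 =1 d2 -> multihomog d2 F.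
Proof. by move=> hF e m /hF h i; rewrite h e. Qed.

Lemma multihomog1 : multihomog (fun=> 0%N) (1 : {mpoly K[n * 3]}).
Proof.
by move=> m; rewrite msupp1 inE => /eqP -> i; rewrite big1 // => j _; rewrite mnm0E.
Qed.

Lemma multihomogX i j :
  multihomog (fun l => nat_of_bool (l == i)) ('X_(mxvec_index i j) : {mpoly K[n * 3]}).
Proof.
move=> m; rewrite msuppX inE => /eqP -> l.
have [->|li] := eqVneq l i.
  rewrite (bigD1 j) //= mnm1E eqxx big1 // => k kj.
  rewrite mnm1E (inj_eq (@cast_ord_inj _ _ _)) (inj_eq enum_rank_inj) xpair_eqE eqxx /=.
  by rewrite eq_sym (negPf kj).
rewrite big1 // => k _.
rewrite mnm1E (inj_eq (@cast_ord_inj _ _ _)) (inj_eq enum_rank_inj) xpair_eqE.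
by rewrite eq_sym (negPf li).
Qed.

Lemma multihomog_prod (I : Type) (r : seq I) (Q : pred I) (F : I -> {mpoly K[n * 3]}) :
  (forall i, Q i -> exists dd, multihomog dd (F i)) ->
  exists dd, multihomog dd (\prod_(i <- r | Q i) F i).
Proof.
move=> h; elim/big_ind: _ => //; first by exists (fun=> 0%N); apply: multihomog1.
by move=> x y [d1 h1] [d2 h2]; exists (fun i => d1 i + d2 i)%N; apply: multihomogM.
Qed.

Lemma multihomog_det N (A : 'M[{mpoly K[n * 3]}]_N) (dd : 'I_N -> 'I_n -> nat) :
  (forall k l, multihomog (dd k) (A k l)) -> exists d', multihomog d' (\det A).
Proof.
move=> hA; exists (fun i => \sum_k dd k i)%N.
rewrite /determinant; elim/big_ind: _ => [||s _]; [exact: multihomog0|exact: multihomogD|].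
have hp : multihomog (fun i => \sum_k dd k i)%N (\prod_k A k (s k)).
  elim: (index_enum _) => [|k r IH].
    by rewrite big_nil; refine (multihomog_eq (@multihomog1) _) => l; rewrite big_nil.
  by rewrite big_cons; refine (multihomog_eq (multihomogM (hA k (s k)) IH) _) => l; rewrite big_cons.
by case: (s : bool); rewrite ?expr1 ?expr0 ?mul1r // mulN1r -scaleN1r; apply: multihomogZ.
Qed.

Definition homcoord (i : 'I_n) : {mpoly K[3]} -> {mpoly K[n * 3]} :=
  mmap (@mpolyC _ K) (fun j => 'X_(mxvec_index i j)).

HB.instance Definition _ i := GRing.RMorphism.copy (homcoord i)
  (mmap (@mpolyC _ K) (fun j => 'X_(mxvec_index i j))).

Lemma homcoordX i j : homcoord i 'X_j = 'X_(mxvec_index i j).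
Proof. by rewrite /homcoord mmapX mmap1U. Qed.

Lemma homcoord_eval i f (v : 'M[K]_(n, 3)) :
  (homcoord i f).@[fun k => mxvec v 0 k] = f.@[v i].
Proof.
rewrite /homcoord /mmap meval_sum mevalE; apply: eq_bigr => m _.
rewrite mevalM mevalC /mmap1 rmorph_prod; congr (_ * _); apply: eq_bigr => j _.
by rewrite rmorphXn /= mevalXU mxvecE.
Qed.

Lemma homcoord_multihomog i d f : f \is d.-homog ->
  multihomog (fun l => if l == i then d else 0%N) (homcoord i f).
Proof.
move: d f; apply: homog_ind => [d|d f g|d c f|//|d j f _ IH].
- by rewrite raddf0; apply: multihomog0.
- by rewrite raddfD; apply: multihomogD.
- by rewrite /homcoord mmapZ mul_mpolyC; apply: multihomogZ.
- rewrite rmorph1; refine (multihomog_eq (@multihomog1) _) => l; exact/esym/if_same.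
- rewrite rmorphM /= homcoordX; refine (multihomog_eq (multihomogM (@multihomogX i j) IH) _) => l /=.
  by case: eqP.
Qed.

End Multihomogeneous.

Section Monomials.
Variable K : fieldType.
Implicit Types f : {mpoly K[3]}.

Definition mons d : seq 'X_{1..3} :=
  [seq s2m t | t : d.-tuple 'I_3 <- enum (basis 3 d)].

Definition mon d (k : 'I_('C(d + 2, d))) : 'X_{1..3} := nth 0%MM (mons d) k.

Lemma mon_mdeg d (k : 'I_('C(d + 2, d))) : mdeg (mon k) = d.
Proof.
by apply/eqP; rewrite basis_cover; apply: mem_nth; rewrite size_basis ltn_ord.
Qed.

Lemma mon_homog d (k : 'I_('C(d + 2, d))) : ('X_[mon k] : {mpoly K[3]}) \is d.-homog.
Proof. by rewrite dhomogX; apply/eqP; apply: mon_mdeg. Qed.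

Lemma mon_inj d : injective (@mon d).
Proof.
move=> k l /eqP; rewrite /mon nth_uniq ?size_basis ?ltn_ord ?uniq_basis // => /eqP.
exact: val_inj.
Qed.

Lemma coef_mons d (c : 'I_('C(d + 2, d)) -> K) l :
  (\sum_k c k *: 'X_[mon k])@_(mon l) = c l.
Proof.
rewrite raddf_sum (bigD1 l) //= mcoeffZ mcoeffX eqxx mulr1 big1 ?addr0 // => k kl.
by rewrite mcoeffZ mcoeffX (inj_eq (@mon_inj d)) (negPf kl) mulr0.
Qed.

Lemma mons_homog d (c : 'I_('C(d + 2, d)) -> K) : \sum_k c k *: 'X_[mon k] \is d.-homog.
Proof. by rewrite rpred_sum // => k _; rewrite rpredZ // mon_homog. Qed.

Lemma mons_expand d f : f \is d.-homog -> f = \sum_k f@_(mon k) *: 'X_[@mon d k].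
Proof.
move=> fd; apply/mpolyP => m.
have [md|md] := eqVneq (mdeg m) d; last first.
  by rewrite !(@dhomog_nemf_coeff _ _ mdeg d) // mons_homog.
have mm : m \in mons d by rewrite -basis_cover md.
have hk : (index m (mons d) < 'C(d + 2, d))%N by rewrite -(size_basis 2 d) index_mem.
have -> : m = mon (Ordinal hk) by rewrite /mon nth_index.
by rewrite coef_mons.
Qed.

Lemma mderiv_mon d (k : 'I_('C(d + 2, d))) i :
  (('X_[mon k] : {mpoly K[3]})^`M(i)) \is d.-1.-homog.
Proof.
move: (mon k) (mon_mdeg k) => m md.
rewrite mderivX; have [->|mi] := posnP (m i); first by rewrite scale0r dhomog0.
rewrite rpredZ // dhomogX; apply/eqP.
have mE : m = (U_(i) + (m - U_(i)))%MM.
  by rewrite addmC submK //; apply/mnm_lepP => j; rewrite mnm1E; case: eqP => // <-.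
suff h : mdeg (m - U_(i))%MM = d.-1 by exact: h.
by rewrite -md [in RHS]mE mdegD mdeg1.
Qed.

End Monomials.

(** * Determinants of linear conditions on forms *)

Section Conditions.
Variables (K : fieldType) (n : nat).
Implicit Types (f : {mpoly K[3]}) (v : 'M[K]_(n, 3)).

(** [Cst] conditions do not move with the points: they fill a system up to a square one when there
    are fewer points than monomials. The single derivative of [Der] is enough to exclude singular
    points. *)
Inductive cond := Ev of 'I_n | Der of 'I_n | Cst of ('I_3 -> K).

Definition cval v c f :=
  match c with Ev i => f.@[v i] | Der i => f^`M(i1).@[v i] | Cst w => f.@[w] end.

Definition cpoly c f : {mpoly K[n * 3]} :=
  match c with
  | Ev i => homcoord i f | Der i => homcoord i f^`M(i1) | Cst w => (f.@[w])%:MP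
  end.

Lemma cpoly_eval c f v : (cpoly c f).@[fun k => mxvec v 0 k] = cval v c f.
Proof. by case: c => [i|i|w] /=; rewrite ?homcoord_eval ?mevalC. Qed.

Lemma cval_sum v c d (x : 'I_('C(d + 2, d)) -> K) :
  cval v c (\sum_k x k *: 'X_[mon k]) = \sum_k x k * cval v c 'X_[mon k].
Proof.
case: c => [i|i|w] /=.
- by rewrite meval_sum; apply: eq_bigr => k _; rewrite mevalZ.
- rewrite (raddf_sum (mderiv i1)) meval_sum; apply: eq_bigr => k _.
  by rewrite /= mderivZ mevalZ.
- by rewrite meval_sum; apply: eq_bigr => k _; rewrite mevalZ.
Qed.

Definition conddet d (r : 'I_('C(d + 2, d)) -> cond) : {mpoly K[n * 3]} :=
  \det (\matrix_(k, l) cpoly (r k) 'X_[mon l]).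

Lemma conddet_multihomog d (r : 'I_('C(d + 2, d)) -> cond) :
  exists dd, multihomog dd (conddet r).
Proof.
apply: (@multihomog_det _ _ _ _ (fun k l => match r k with
  | Ev i => if l == i then d else 0%N | Der i => if l == i then d.-1 else 0%N
  | Cst w => 0%N end)) => k l; rewrite mxE; case: (r k) => [i|i|w] /=.
- by apply: homcoord_multihomog; apply: mon_homog.
- by apply: homcoord_multihomog; apply: mderiv_mon.
- by rewrite -[_%:MP]mulr1 mul_mpolyC; apply: multihomogZ; apply: multihomog1.
Qed.

Lemma conddet_eval d (r : 'I_('C(d + 2, d)) -> cond) v :
  (conddet r).@[fun k => mxvec v 0 k] = \det (\matrix_(k, l) cval v (r k) 'X_[mon l]).
Proof.
rewrite -det_map_mx; congr (\det _); apply/matrixP => k l; rewrite !mxE.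
exact: cpoly_eval.
Qed.

(** A single configuration whose conditions kill every form already gives the determinant a nonzero
    value. *)
Lemma conddet_neq0 d (r : 'I_('C(d + 2, d)) -> cond) v :
  (forall f, f \is d.-homog -> (forall k, cval v (r k) f = 0) -> f = 0) ->
  conddet r != 0.
Proof.
move=> h; have : (conddet r).@[fun k => mxvec v 0 k] != 0.
  rewrite conddet_eval -det_tr; apply/det0P => -[c c0 cM]; case/eqP: c0.
  have f0 := h _ (mons_homog (fun k => c 0 k)).
  apply/rowP => l; rewrite mxE -(coef_mons (fun k => c 0 k) l) f0 ?mcoeff0 // => k.
  rewrite cval_sum; have := congr1 (fun A : 'rV__ => A 0 k) cM; rewrite !mxE => {2}<-.
  by apply: eq_bigr => j _; rewrite !mxE.
by apply: contraNneq => ->; rewrite meval0.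
Qed.

Lemma conddet_solve d (r : 'I_('C(d + 2, d)) -> cond) v (y : 'I_('C(d + 2, d)) -> K) :
  (conddet r).@[fun k => mxvec v 0 k] != 0 ->
  exists f, f \is d.-homog /\ forall k, cval v (r k) f = y k.
Proof.
rewrite conddet_eval; set M := (\matrix_(k, l) _) => dM.
pose c := invmx M *m \col_k y k.
exists (\sum_k c k 0 *: 'X_[mon k]); split=> [|k]; first exact: mons_homog.
have : M *m c = \col_k y k by rewrite mulKVmx // unitmxE unitfE.
move=> /(congr1 (fun A : 'cV__ => A k 0)); rewrite !mxE => <-.
by rewrite cval_sum; apply: eq_bigr => j _; rewrite !mxE mulrC.
Qed.

Lemma conddet_inj d (r : 'I_('C(d + 2, d)) -> cond) v f :
  (conddet r).@[fun k => mxvec v 0 k] != 0 -> f \is d.-homog ->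
  (forall k, cval v (r k) f = 0) -> f = 0.
Proof.
rewrite conddet_eval; set M := (\matrix_(k, l) _) => dM fd f0.
pose c : 'cV_('C(d + 2, d)) := \col_k f@_(mon k).
have Mc : M *m c = 0.
  apply/colP => k; rewrite !mxE; apply: etrans (f0 k).
  rewrite [in RHS](mons_expand fd) cval_sum.
  by apply: eq_bigr => j _; rewrite !mxE mulrC.
have c0 : c = 0 by rewrite -(mulKmx (_ : M \in unitmx) c) ?Mc ?mulmx0 // unitmxE unitfE.
rewrite (mons_expand fd) big1 // => k _.
by have := congr1 (fun A : 'cV__ => A k 0) c0; rewrite !mxE => ->; rewrite scale0r.
Qed.

End Conditions.

Section GeneralPosition.
Variables (K : fieldType) (n : nat).
Hypothesis K_infinite : infinite_set [set: K].
Local Notation form d := (dhomog 3 K d).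
Local Notation N d := 'C(d + 2, d).
Implicit Types (f : {mpoly K[3]}) (v : 'M[K]_(n, 3)).

(** Each new vector is taken off the zeros of a nonzero form still in the space, so the dimension
    drops every time. *)
Lemma points_kill d D (U : {vspace (form d)}) : (\dim U <= D)%N ->
  exists w : nat -> 'I_3 -> K, forall f : form d, f \in U ->
    (forall j, (j < D)%N -> (val f).@[w j] = 0) -> f = 0.
Proof.
elim: D U => [|D IH] U.
  rewrite leqn0 dimv_eq0 => /eqP ->; exists (fun _ _ => 0) => f.
  by rewrite memv0 => /eqP.
have [->|U0] := eqVneq U 0%VS.
  by move=> _; exists (fun _ _ => 0) => f; rewrite memv0 => /eqP.
move=> dU; have g0 : vpick U != 0 by rewrite vpick0.
have [|w hw] := nonvanishing_point K_infinite (f := val (vpick U)).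
  by apply: contraNneq g0 => h; apply/eqP/val_inj.
have [|phi E] := @hom_of_linear _ _ _ (fun f : form d => (val f).@[w]%:M : 'rV[K]_1).
  by move=> c x y; rewrite /= mevalD mevalZ raddfD /= scale_scalar_mx.
have [|w' hw'] := IH (U :&: lker phi)%VS.
  rewrite -ltnS; apply: leq_trans dU; rewrite ltn_neqAle dimvS ?capvSl // andbT.
  apply: contraNneq hw => /eqP; rewrite dimv_leqif_eq ?capvSl // => /eqP e.
  have : vpick U \in (U :&: lker phi)%VS by rewrite e memv_pick.
  rewrite memv_cap memv_ker E => /andP[_ /eqP /matrixP /(_ 0 0)].
  by rewrite !mxE eqxx mulr1n => ->.
exists (fun j => if j is j'.+1 then w' j' else w) => f fU f0.
apply: hw' => [|j jD]; last exact: (f0 j.+1).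
rewrite memv_cap fU memv_ker E (f0 0%N) //.
by apply/eqP; rewrite raddf0.
Qed.

Lemma points_kill_all d : exists w : nat -> 'I_3 -> K, forall f, f \is d.-homog ->
  (forall j, (j < N d)%N -> f.@[w j] = 0) -> f = 0.
Proof.
have [w hw] := points_kill (eq_leq (dim_forms K d)).
by exists w => f fd f0; have /(congr1 val) := hw (DHomog fd) (memvf _) f0.
Qed.

(** [x0^d] and [x1 x0^(d-1)] show that value and derivative at [(1 : 0 : 0)] are independent in
    every characteristic, which leaves dimension [N d - 2]. *)
Lemma points_kill_tangent d : (0 < d)%N -> exists w : nat -> 'I_3 -> K, forall f, f \is d.-homog ->
  f.@[fun i => (i == i0)%:R] = 0 -> f^`M(i1).@[fun i => (i == i0)%:R] = 0 ->
  (forall j, (j < N d - 2)%N -> f.@[w j] = 0) -> f = 0.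
Proof.
move=> d0; pose w0 : 'I_3 -> K := fun i => (i == i0)%:R.
pose F (f : form d) : 'rV[K]_2 := \row_k (if k == 0 then (val f).@[w0] else (val f)^`M(i1).@[w0]).
have [|phi E] := @hom_of_linear _ _ _ F.
  move=> c x y; apply/rowP => k; rewrite !mxE /=; case: eqP => _.
    by rewrite mevalD mevalZ.
  by rewrite mderivD mderivZ mevalD mevalZ.
have full : limg phi = fullv.
  have h0 : ('X_i0 ^+ d : {mpoly K[3]}) \is d.-homog by apply: dhomogXn; apply: dhomogXU.
  have h1 : ('X_i1 * 'X_i0 ^+ d.-1 : {mpoly K[3]}) \is d.-homog.
    apply: (@dhomogM_eq _ _ 1 d.-1); rewrite ?dhomogXU //; last by rewrite add1n prednK.
    by apply: dhomogXn; apply: dhomogXU.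
  have d01 : ('X_i0 : {mpoly K[3]})^`M(i1) = 0 by rewrite mderivX mnm1E scale0r.
  have d0X k : ('X_i0 ^+ k : {mpoly K[3]})^`M(i1) = 0.
    elim: k => [|k IH]; first by rewrite expr0 -mpolyC1 mderivC.
    by rewrite exprS mderivM d01 IH mul0r mulr0 addr0.
  have d11 : ('X_i1 : {mpoly K[3]})^`M(i1) = 1.
    rewrite mderivX mnm1E eqxx scale1r (_ : (U_(i1) - U_(i1))%MM = 0%MM) ?mpolyX0 //.
    by apply/mnmP => j; rewrite mnmBE mnm0E subnn.
  apply/vspaceP => r; rewrite memvf.
  apply/memv_imgP; exists (r 0 0 *: (DHomog h0 : form d) + r 0 1 *: (DHomog h1 : form d)).
    exact: memvf.
  rewrite E; apply/rowP => k; rewrite !mxE /=.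
  case: eqP => [->|/eqP k0].
    rewrite mevalD !mevalZ mevalM !rmorphXn /= !mevalXU /w0 /= mul0r mulr0 addr0.
    by rewrite expr1n mulr1.
  have -> : k = 1 by apply: val_inj; case: k k0 => [[|[|]]].
  rewrite mderivD !mderivZ d0X mderivM d0X d11 mulr0 mul1r addr0 scaler0 add0r.
  by rewrite mevalZ rmorphXn /= mevalXU /w0 eqxx expr1n mulr1.
have dk : (\dim (lker phi) <= N d - 2)%N.
  have := limg_ker_dim phi fullv; rewrite full capfv dim_row dim_forms => <-.
  by rewrite addnK.
have [w hw] := points_kill dk.
exists w => f fd f0 f1 fw.
have fker : (DHomog fd : form d) \in lker phi.
  by rewrite memv_ker E; apply/eqP/rowP => k; rewrite !mxE; case: ifP.
by have := hw _ fker fw; apply: (congr1 val).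
Qed.

(** The indices other than [k1] name distinct points, and the point of [k1] is one of them: it
    carries a derivative condition besides its value. *)
Definition inj_off d (J : 'I_(N d) -> 'I_n) k1 :=
  [forall k, forall l, [&& k != k1, l != k1 & J k == J l] ==> (k == l)] &&
  [exists k0, (k0 != k1) && (J k0 == J k1)].

(** The last clause is nonsingularity in disguise: a form vanishing at one point fewer than its
    degree has monomials, and singular at one of them, is zero. The bound [d <= n] keeps the list of
    open conditions finite. *)
Definition general_position s v :=
  [/\ forall i, v i i0 != 0,
      forall i, exists f, f \is s.-homog /\ forall j, f.@[v j] = (i == j)%:R,
      forall d (J : 'I_(N d) -> 'I_n) f, (d <= n)%N -> injective J -> f \is d.-homog ->
        (forall k, f.@[v (J k)] = 0) -> f = 0
    & forall d (J : 'I_(N d) -> 'I_n) k1 f, (d <= n)%N -> inj_off J k1 -> f \is d.-homog ->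
        (forall k, k != k1 -> f.@[v (J k)] = 0) -> f^`M(i1).@[v (J k1)] = 0 -> f = 0].

Lemma independent_neq0 d (J : 'I_(N d) -> 'I_n) : injective J ->
  conddet (fun k => @Ev K n (J k)) != 0.
Proof.
move=> Jinj; have [w hw] := points_kill_all d.
apply: (@conddet_neq0 _ _ _ _
  (\matrix_(i, j) (if [pick k | J k == i] is Some k then w k j else 0))) => f fd f0.
apply: hw => // j jN; rewrite -(f0 (Ordinal jN)); apply: meval_eq => i; rewrite mxE.
by case: pickP => [k /eqP /Jinj -> //|/(_ (Ordinal jN))]; rewrite eqxx.
Qed.

Lemma tangent_neq0 d (J : 'I_(N d) -> 'I_n) k1 : inj_off J k1 ->
  conddet (fun k => if k == k1 then @Der K n (J k) else Ev K (J k)) != 0.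
Proof.
case/andP=> /forallP Jinj /existsP [k0 /andP[k01 /eqP Jk]].
have {}Jinj k l : k != k1 -> l != k1 -> J k = J l -> k = l.
  move=> kk lk e; have := forallP (Jinj k) l; rewrite kk lk e eqxx => /eqP; exact.
have d0 : (0 < d)%N.
  case: d J k0 k1 k01 {Jinj Jk} => // J k0 k1.
  have e (k : 'I_(N 0)) : k = 0%N :> nat by case: k => k; rewrite bin0; case: k.
  by rewrite -val_eqE /= !e.
have [w hw] := points_kill_tangent d0.
pose rest := enum [pred k | (k != k0) && (k != k1)].
have srest : size rest = (N d - 2)%N.
  rewrite -cardE; have := cardC [pred k | (k != k0) && (k != k1)].
  rewrite card_ord; have -> : #|[predC [pred k | (k != k0) && (k != k1)]]| = 2.
    rewrite (@eq_card _ _ (pred2 k0 k1)) ?card2 ?k01 // => k.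
    by rewrite !inE negb_and !negbK.
  by move=> /(congr1 (fun x => x - 2)%N); rewrite addnK.
(* The point with the tangent condition is placed at [(1 : 0 : 0)], the others at the vectors that
   kill the remaining forms. *)
pose v : 'M[K]_(n, 3) := \matrix_(i, j) if i == J k0 then (j == i0)%:R else
  if [pick k in rest | J k == i] is Some k then w (index k rest) j else 0.
apply: (@conddet_neq0 _ _ _ _ v) => f fd f0; apply: hw => //.
- rewrite -(f0 k0) (negPf k01) /=; apply: meval_eq => i.
  by rewrite mxE eqxx.
- rewrite -(f0 k1) eqxx /=; apply: meval_eq => i.
  by rewrite mxE -Jk eqxx.
move=> j; rewrite -srest => jr; set k := nth k0 rest j.
have kr : k \in rest by apply: mem_nth.
have : (k != k0) && (k != k1) by have := kr; rewrite mem_enum.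
case/andP=> kk0 kk1.
rewrite -(f0 k) (negPf kk1) /=; apply: meval_eq => i; rewrite mxE.
have -> : (J k == J k0) = false.
  by apply: contraNF kk0 => /eqP e; apply/eqP; apply: Jinj.
case: pickP => [l /andP[lr /eqP e]|/(_ k)]; last by rewrite kr eqxx.
have -> : l = k.
  apply: Jinj => //; have := lr; rewrite mem_enum => /andP[] //.
by rewrite /k index_uniq // enum_uniq.
Qed.

Lemma general_position_open s : (n <= N s)%N -> exists F : {mpoly K[n * 3]},
  [/\ exists dd, multihomog dd F, F != 0
    & forall v, F.@[fun k => mxvec v 0 k] != 0 -> general_position s v].
Proof.
move=> ns; have [w hw] := points_kill_all s.
(* The first [n] conditions are evaluations at the points; fixed vectors fill the remaining rows.
   Solving the system then yields the separators. *)
pose sep (k : 'I_(N s)) := if insub (val k) is Some i then @Ev K n i else Cst n (w k).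
pose F0 : {mpoly K[n * 3]} := \prod_i 'X_(mxvec_index i i0).
pose F1 := conddet sep.
pose F2 := \prod_(d < n.+1) \prod_(J : {ffun 'I_(N d) -> 'I_n} | injectiveb J)
  conddet (fun k => @Ev K n (J k)).
pose F3 := \prod_(d < n.+1) \prod_(J : {ffun 'I_(N d) -> 'I_n}) \prod_(k1 | inj_off J k1)
  conddet (fun k => if k == k1 then @Der K n (J k) else Ev K (J k)).
exists (F0 * F1 * F2 * F3); split.
- have mM (F G : {mpoly K[n * 3]}) : (exists dd, multihomog dd F) ->
      (exists dd, multihomog dd G) -> exists dd, multihomog dd (F * G).
    by move=> [d1 h1] [d2 h2]; exists (fun i => d1 i + d2 i)%N; apply: multihomogM.
  apply: (mM); [apply: (mM); [apply: (mM)|]|].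
  + by apply: multihomog_prod => i _; eexists; apply: multihomogX.
  + exact: conddet_multihomog.
  + by apply: multihomog_prod => d _; apply: multihomog_prod => J _; apply: conddet_multihomog.
  + apply: multihomog_prod => d _; apply: multihomog_prod => J _.
    by apply: multihomog_prod => k _; apply: conddet_multihomog.
- rewrite !mulf_neq0 //.
  + apply/prodf_neq0 => i _; apply: contraTneq isT => h.
    by have := msuppX K (U_(mxvec_index i i0))%MM; rewrite h msupp0.
  + apply: (@conddet_neq0 _ _ _ _ (\matrix_(i, j) w i j)) => f fs f0.
    apply: hw => // j jN; rewrite -(f0 (Ordinal jN)) /sep /=.
    case: insubP => [i _ ij|_] /=; last by [].
    by apply: meval_eq => l; rewrite mxE ij.
  + apply/prodf_neq0 => d _; apply/prodf_neq0 => J /injectiveP; exact: independent_neq0.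
  + apply/prodf_neq0 => d _; apply/prodf_neq0 => J _; apply/prodf_neq0 => k1.
    exact: tangent_neq0.
move=> v; rewrite !mevalM !mulf_eq0 !negb_or => /andP[/andP[/andP[h0 h1] h2] h3].
split.
- move=> i; move: h0; rewrite rmorph_prod => /prodf_neq0 /(_ i isT).
  by rewrite /= mevalXU mxvecE.
- move=> i; have [f [fs fE]] := conddet_solve (fun k => (val k == val i)%:R) h1.
  exists f; split=> // j.
  have jN : (j < N s)%N by apply: leq_trans ns.
  have := fE (Ordinal jN); rewrite /sep /=; case: insubP => [l _ lj|]; last by rewrite ltn_ord.
  by rewrite (_ : l = j); [move=> /= ->; rewrite eq_sym | apply: val_inj].
- move=> d J f dn Jinj fd f0.
  move: h2; rewrite rmorph_prod => /prodf_neq0 /(_ (Ordinal (dn : (d < n.+1)%N)) isT).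
  rewrite rmorph_prod => /prodf_neq0 /(_ [ffun k => J k]) /=.
  have -> : injectiveb [ffun k => J k].
    by apply/injectiveP => k l; rewrite !ffunE; apply: Jinj.
  move=> /(_ isT) h.
  by apply: (conddet_inj h) => // k /=; rewrite ffunE.
- move=> d J k1 f dn Jk fd f0 f1.
  move: h3; rewrite rmorph_prod => /prodf_neq0 /(_ (Ordinal (dn : (d < n.+1)%N)) isT).
  rewrite rmorph_prod => /prodf_neq0 /(_ [ffun k => J k] isT) /=.
  rewrite rmorph_prod => /prodf_neq0 /(_ k1) /=.
  have -> : inj_off [ffun k => J k] k1.
    case/andP: Jk => /forallP Jk /existsP [k0 hk0]; apply/andP; split.
      by apply/forallP => k; apply/forallP => l; rewrite !ffunE; apply: (forallP (Jk k)).
    by apply/existsP; exists k0; rewrite !ffunE.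
  move=> /(_ isT) h; apply: (conddet_inj h) => // k /=.
  by case: eqP => [->|/eqP kk] /=; rewrite ffunE //; apply: f0.
Qed.

End GeneralPosition.

(** * Lower bounds for the degree *)

Lemma homog_meval_scale (K : fieldType) k (c : K) (w : 'I_k -> K) d (f : {mpoly K[k]}) :
  f \is d.-homog -> f.@[fun j => c * w j] = c ^+ d * f.@[w].
Proof.
move: d f; apply: homog_ind => [d|d f g hf hg|d x f hf||d i f _ hf].
- by rewrite !meval0 mulr0.
- by rewrite !mevalD hf hg mulrDr.
- by rewrite !mevalZ hf mulrCA.
- by rewrite !meval1 expr0 mulr1.
- by rewrite !mevalM !mevalXU hf exprS; ring.
Qed.

Lemma card_ord_pred n m (P : pred nat) : (m <= n)%N -> (forall k, P k -> (k < m)%N) ->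
  #|[set i : 'I_n | P i]| = count P (iota 0 m).
Proof.
move=> mn hP; rewrite cardsE -sum1_card (eq_bigl (fun i : 'I_n => P i)) //.
rewrite -(big_mkord P (fun=> 1%N)) /index_iota subn0 sum1_count.
rewrite -(subnKC mn) iotaD count_cat [X in (_ + X)%N](_ : _ = 0%N) ?addn0 //.
apply/eqP; rewrite -leqn0 leqNgt -has_count; apply/hasPn => k.
by rewrite mem_iota => /andP[mk _]; apply: contraTN mk => /hP; rewrite -ltnNge.
Qed.

Lemma sum_mem_card (T : finType) (A B : {set T}) :
  (\sum_(i in A) (i \in B) = #|A :&: B|)%N.
Proof.
rewrite -sum1_card big_mkcond [RHS]big_mkcond; apply: eq_bigr => i _.
by rewrite inE; case: (i \in A); case: (i \in B).
Qed.

Section Consequences.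
Variables (K : fieldType) (n s : nat) (v : 'M[K]_(n, 3)).
Hypothesis gp : general_position s v.
Local Notation N d := 'C(d + 2, d).
Implicit Types (f D : {mpoly K[3]}) (S : {set 'I_n}).

Definition xcoord i := v i i1 / v i i0.
Definition ycoord i := v i i2 / v i i0.
Local Notation mult i := (vge (xcoord i) (ycoord i)).

Let v0 i : v i i0 != 0.
Proof. by case: gp. Qed.

Let vE i j : v i j = v i i0 * affpt (xcoord i) (ycoord i) j.
Proof. by case: (I3P j) => ->; rewrite /affpt /= ?mulr1 // mulrC divfK. Qed.

Lemma meval_point i d f : f \is d.-homog ->
  f.@[v i] = v i i0 ^+ d * f.@[affpt (xcoord i) (ycoord i)].
Proof. by move=> fd; rewrite -(homog_meval_scale _ _ fd); apply: meval_eq => j. Qed.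

Lemma mult1P i d f : f \is d.-homog -> mult i 1 f <-> f.@[v i] = 0.
Proof.
move=> fd; rewrite vge1P (meval_point i fd); split=> [->|/eqP]; first by rewrite mulr0.
by rewrite mulf_eq0 expf_eq0 (negPf (v0 i)) andbF => /eqP.
Qed.

Lemma points_separators : exists e : 'I_n -> {mpoly K[3]}, (forall i, e i \is s.-homog) /\
  forall i j, (e i).@[affpt (xcoord j) (ycoord j)] = (i == j)%:R.
Proof.
case: gp => _ /boolp.choice [e he] _ _.
exists (fun i => v i i0 ^+ s *: e i); split=> [i|i j]; first by rewrite rpredZ //; case: (he i).
have [eh /(_ j)] := he i; rewrite (meval_point _ eh) mevalZ.
case: eqP => [<- //|_ /eqP]; rewrite mulf_eq0 expf_eq0 (negPf (v0 j)) andbF => /eqP ->.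
exact: mulr0.
Qed.

Lemma points_distinct i j : i != j -> (xcoord i, ycoord i) != (xcoord j, ycoord j).
Proof.
have [e [_ eE]] := points_separators; apply: contra => /eqP [xE yE].
have := eE i j; rewrite -xE -yE eE eqxx.
by case: eqP => // _ /eqP; rewrite oner_eq0.
Qed.

Definition zeros D : {set 'I_n} := [set i | D.@[v i] == 0].

Lemma card_zeros d D : (d <= n)%N -> D \is d.-homog -> D != 0 -> (#|zeros D| < N d)%N.
Proof.
move=> dn Dd; apply: contraNltn => h; apply/eqP.
case: gp => _ _ /(_ d (fun k => enum_val (widen_ord h k)) D dn) H _.
apply: H => // [k l /enum_val_inj /(congr1 val) /= e|k]; first exact: val_inj.
by have := enum_valP (widen_ord h k); rewrite inE => /eqP.
Qed.

(** The values at [S] and one derivative are as many conditions as there are monomials of degree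
    [d]; a double point at [i] would satisfy them all. *)
Lemma curve_nonsingular d S f i : (d <= n)%N -> #|S|.+1 = N d -> f \is d.-homog -> f != 0 ->
  {in S, forall j, mult j 1 f} -> i \in S -> ~ mult i 2 f.
Proof.
move=> dn cS fd f0 fS iS f2; case/eqP: f0.
case: d => [|d] in dn cS fd *.
  by move: cS; rewrite bin0 => -[/eqP]; rewrite cards_eq0 => /eqP S0; rewrite S0 inE in iS.
have szS : size (enum S) = #|S| by rewrite -cardE.
have sz (k : 'I_(N d.+1)) : k != 0%N :> nat -> (k.-1 < size (enum S))%N.
  by rewrite szS -ltnS cS -lt0n => /prednK ->.
have k1N : (0 < N d.+1)%N by rewrite -cS.
(* Index 0 carries the derivative at [i]; the other indices run through [S], where [i] occurs
   again. *)
pose J (k : 'I_(N d.+1)) := nth i (i :: enum S) k.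
have JE (k : 'I_(N d.+1)) : k != 0%N :> nat -> J k = nth i (enum S) k.-1.
  by rewrite /J; case: (nat_of_ord k).
have JS (k : 'I_(N d.+1)) : k != 0%N :> nat -> J k \in S.
  by move=> k0; rewrite JE // -mem_enum mem_nth // sz.
case: gp => _ _ _ /(_ _ J (Ordinal k1N) f dn) H; apply: H => //.
- apply/andP; split.
    apply/forallP => k; apply/forallP => l; apply/implyP => /and3P[k0 l0].
    rewrite !JE // nth_uniq ?enum_uniq ?sz // => /eqP kl; apply/eqP/val_inj => /=.
    rewrite -!val_eqE /= in k0 l0; move: kl k0 l0; move: (nat_of_ord k) (nat_of_ord l).
    by move=> x y; lia.
  have hi : ((index i (enum S)).+1 < N d.+1)%N.
    by rewrite -cS ltnS -szS index_mem mem_enum.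
  by apply/existsP; exists (Ordinal hi); rewrite /J /= nth_index ?mem_enum ?eqxx.
- by move=> k k0; apply/(mult1P _ fd)/fS/JS.
rewrite {1}/J /=.
have [f1 [f2' [f1h f2h /(mult1P _ f1h) f1i /(mult1P _ f2h) f2i ->]]] := vgeS_split fd f2.
have ui : (lu (xcoord i)).@[v i] = 0 by apply/(mult1P _ (lu_homog _))/vge_u.
have vi : (lv (ycoord i)).@[v i] = 0 by apply/(mult1P _ (lv_homog _))/vge_v.
by rewrite mderivD !mderivM !mevalD !mevalM ui vi f1i f2i !mulr0 !mul0r !addr0.
Qed.

Lemma curve_exists d S : (d <= n)%N -> #|S|.+1 = N d -> exists C : {mpoly K[3]},
  [/\ C \is d.-homog, C != 0 & {in S, forall i, mult i 1 C /\ ~ mult i 2 C}].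
Proof.
move=> dn cS; have [U [hU dU]] := codim_fat xcoord ycoord (fun i => (i \in S) : nat) d.
have U0 : U != 0%VS.
  rewrite -dimv_eq0 -lt0n; move: dU; rewrite -cS (_ : (\sum_i _)%N = #|S|).
    by rewrite -add1n leq_add2r.
  rewrite -sum1_card [RHS]big_mkcond; apply: eq_bigr => i _; by case: (i \in S).
have C1 : {in S, forall i, mult i 1 (val (vpick U))}.
  by move=> i iS; have := hU _ (memv_pick U) i; rewrite iS.
have C0 : val (vpick U) != 0.
  by move: U0; rewrite -vpick0; apply: contraNneq => h; apply/eqP/val_inj.
have Cd := dhomog_is_dhomog (vpick U).
exists (val (vpick U)); split=> // i iS; split; first exact: C1.
exact: (curve_nonsingular dn cS Cd C0 C1 iS).
Qed.

Lemma zerosP i d D : D \is d.-homog -> reflect (mult i 1 D) (i \in zeros D).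
Proof.
move=> Dd; rewrite inE; apply: (iffP eqP) => h; first by apply/(mult1P _ Dd).
by apply/(mult1P _ Dd).
Qed.

Lemma mult_zeros i d D : D \is d.-homog -> ~ mult i 2 D -> ~ mult i (i \in zeros D).+1 D.
Proof.
by move=> Dd D2; case: (zerosP i Dd) => h.
Qed.

Lemma mult_divides i m D f : divides D f -> ~ mult i m f -> ~ mult i m D.
Proof. by move=> [x ->] h hD; apply: h; apply: vgeMl. Qed.

Lemma divides_neq0 D f : divides D f -> f != 0 -> D != 0.
Proof. by move=> [x ->]; apply: contraNneq => ->; rewrite mulr0. Qed.

(** A component of degree [e] passes through at most [e(e+3)/2] of the points, and this is at most
    [e * d] because [e <= d] and [d >= 3]. *)
Lemma degree_bound_curve d t r F : (3 <= d)%N -> (N d <= n)%N ->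
  F \is t.-homog -> F != 0 -> (forall i, mult i (2 * r) F) -> (r * (d + 3) <= t)%N.
Proof.
move=> d3 Nn Ft F0 hF.
have tri := tri_bin d.
have dn : (d <= n)%N by nia.
pose S := [set i : 'I_n | (i < (N d).-1)%N].
have cS : #|S| = (N d).-1.
  rewrite (@card_ord_pred n (N d).-1 (fun k => k < (N d).-1)%N) //; last exact: leq_trans (leq_pred _) _.
  rewrite -[RHS](size_iota 0) -[RHS]count_predT; apply/eq_in_count => k.
  by rewrite mem_iota add0n.
have [|C [Cd C0 CS]] := curve_exists (S := S) dn; first by rewrite cS prednK //; lia.
have := @nef_curve K n xcoord ycoord points_distinct 1 (fun=> C) (fun=> d) (fun=> S).
move=> /(_ _ _ t F (fun=> 2 * r)%N Ft F0 hF).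
rewrite !big_ord1 sum_nat_const cS => H.
suff : ((N d).-1 * (2 * r) <= t * d)%N.
  have : ((N d).-1 * 2 = d * (d + 3))%N by rewrite -subn1 mulnBl tri; nia.
  move: (N d).-1 => x hx; rewrite mulnA hx mulnAC -mulnA [(t * d)%N]mulnC.
  by rewrite leq_pmul2l 1?mulnC //; lia.
apply: H => [_|_ D e De e0 DC].
  by split=> // i /CS [].
have D0 := divides_neq0 DC C0.
have ed : (e <= d)%N.
  by have [c [cd Dc]] := divides_homog Cd C0 DC; rewrite (dhomog_uniq D0 De Dc).
(* On [S] the multiplicity is at most one, by nonsingularity of [C]; off [S] it is not counted, and
   the degree [e] is bound enough. *)
exists (fun i => if i \in S then (i \in zeros D) : nat else e); split=> [i|].
  case: ifP => [/CS [_ C2]|_]; first exact: mult_zeros De (mult_divides DC C2).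
  by move=> /(vge_deg De) /(_ (ltnSn e)) /eqP; rewrite (negPf D0).
rewrite !big_ord1 (eq_bigr (fun i => (i \in zeros D) : nat)) => [|i -> //].
rewrite sum_mem_card; apply: leq_trans (subset_leq_card (finset.subsetIr _ _)) _.
have := card_zeros (leq_trans ed dn) De D0; have := tri_bin e.
move: #|_| (N e) => x y hy xy; nia.
Qed.

(** [T j] holds the two points that determine the [j]-th line, [S j] those that are counted. With
    three points the two lines share one of them, which must be counted once only. *)
Lemma degree_bound_lines (S T : 'I_2 -> {set 'I_n}) t r F : (1 <= n)%N ->
  (forall j, #|T j| = 2 /\ S j \subset T j) -> [disjoint S 0 & S 1] ->
  F \is t.-homog -> F != 0 -> (forall i, mult i (2 * r) F) ->
  ((#|S 0%R| + #|S 1%R|) * r <= t)%N.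
Proof.
move=> n1 hST dS Ft F0 hF.
have curves j : exists C : {mpoly K[3]},
    [/\ C \is 1.-homog, C != 0 & {in T j, forall i, mult i 1 C /\ ~ mult i 2 C}].
  by apply: curve_exists => //; have [-> _] := hST j.
have [C hC] := boolp.choice curves.
have H := @nef_curve K n xcoord ycoord points_distinct 2 C (fun=> 1%N) S _ _ t F (fun=> 2 * r)%N Ft F0 hF.
have {H} : (\sum_(k < 2) \sum_(i in S k) 2 * r <= t * \sum_(k < 2) 1)%N.
  apply: H => [j|j D e De e0 DC].
    have [Cd C0 CT] := hC j; split=> // i iS; have [_ /fintype.subsetP ST] := hST j.
    by have [] := CT i (ST i iS).
  have [Cd C0 _] := hC j.
  have D0 := divides_neq0 DC C0.
  have e1 : e = 1%N.
    have [c [cd Dc]] := divides_homog Cd C0 DC; have := dhomog_uniq D0 De Dc; lia.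
  rewrite e1 in De *; exists (fun i => (i \in zeros D) : nat); split=> [i|].
    apply: (mult_zeros De) => /(vge_deg De) /(_ isT) /eqP; by rewrite (negPf D0).
  rewrite !big_ord_recl !big_ord0 !sum_mem_card !addn0 mul1n.
  have -> : lift ord0 ord0 = 1 :> 'I_2 by apply: val_inj.
  rewrite -cardsUI -finset.setIUl -finset.setIIl.
  have -> : S 0 :&: S 1 = finset.set0 by apply/eqP; rewrite finset.setI_eq0.
  rewrite finset.set0I cards0 addn0; apply: leq_trans (subset_leq_card (finset.subsetIr _ _)) _.
  by have := card_zeros n1 De D0.
rewrite !big_ord_recl !big_ord0 !sum_nat_const !addn0 -mulnDl.
have -> : lift ord0 ord0 = 1 :> 'I_2 by apply: val_inj.
by move: (_ + _)%N => x; rewrite mulnCA mulnC leq_pmul2r.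
Qed.

Lemma degree_bound_conics t r F : (7 <= n)%N ->
  F \is t.-homog -> F != 0 -> (forall i, mult i (2 * r) F) -> (5 * r <= t)%N.
Proof.
move=> n7 Ft F0 hF.
(* Five points on each conic, three of them shared: against the pair, of total degree 4, each conic
   counts [5 + 3 = 2 * 4], and a line at most [2 + 2 = 4]. *)
pose P (j : 'I_2) (k : nat) := if j == 0 then (k < 5)%N else (k < 3)%N || (k \in [:: 5; 6]).
pose S j := [set i : 'I_n | P j i].
have P7 j k : P j k -> (k < 7)%N.
  rewrite /P; case: ifP => _; first by move=> h; apply: ltn_trans h _.
  by rewrite !inE => /or3P[h|/eqP ->|/eqP ->] //; apply: ltn_trans h _.
have cS j : #|S j| = 5 by rewrite (card_ord_pred n7 (P7 j)) /P; case: (j == 0).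
have cI j k : j != k -> #|S j :&: S k| = 3.
  move=> jk; have -> : S j :&: S k = [set i : 'I_n | P j i && P k i].
    by apply/finset.setP => i; rewrite !inE.
  rewrite (card_ord_pred (P := fun l => P j l && P k l) n7) => [|l /andP[/P7 //]].
  by move: jk; rewrite /P; case: j => [[|[|]]] // ?; case: k => [[|[|]]].
have curves j : exists C : {mpoly K[3]},
    [/\ C \is 2.-homog, C != 0 & {in S j, forall i, mult i 1 C /\ ~ mult i 2 C}].
  by apply: curve_exists; [exact: leq_trans n7 | rewrite cS].
have [C hC] := boolp.choice curves.
have H := @nef_curve K n xcoord ycoord points_distinct 2 C (fun=> 2%N) S _ _ t F (fun=> 2 * r)%N Ft F0 hF.
have {H} : (\sum_(k < 2) \sum_(i in S k) 2 * r <= t * \sum_(k < 2) 2)%N.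
  apply: H => [j|j D e De e0 DC].
    by have [Cd C0 CS] := hC j; split=> // i /CS [].
  have [Cd C0 CS] := hC j.
  have D0 := divides_neq0 DC C0.
  have e2 : (e <= 2)%N.
    by have [c [cd Dc]] := divides_homog Cd C0 DC; rewrite (dhomog_uniq D0 De Dc).
  have n2 : (2 <= n)%N by apply: leq_trans n7.
  have zD := card_zeros (leq_trans e2 n2) De D0.
  have sE : (\sum_(k < 2) \sum_(i in S k) (i \in zeros D) = #|S 0%R :&: zeros D| + #|S 1%R :&: zeros D|)%N.
    rewrite !big_ord_recl big_ord0 !sum_mem_card addn0.
    by have -> : lift ord0 ord0 = 1 :> 'I_2 by apply: val_inj.
  (* A component of degree two is the conic up to a constant, and six zeros are excluded by
     [card_zeros]. *)
  have zE : e = 2%N -> zeros D = S j.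
    move=> eE; rewrite eE in De zD; apply/esym/eqP.
    rewrite eqEcard cS -ltnS zD andbT; apply/fintype.subsetP => i /CS [].
    move=> /(mult1P _ Cd) Ci _; apply/(zerosP _ De)/(mult1P _ De).
    have [x xE] := DC; rewrite xE in Cd C0 Ci.
    have [_ x0] := homog_divr Cd C0 De; have xC := homog0_const x0.
    have c0 : x@_0 != 0.
      by apply: contraNneq C0 => c0; rewrite xC c0 mpolyC0 mul0r.
    by move: Ci; rewrite xC mevalM mevalC => /eqP; rewrite mulf_eq0 (negPf c0) => /eqP.
  have [eE|eE] : e = 1%N \/ e = 2%N by lia.
    rewrite eE in De zD *; exists (fun i => (i \in zeros D) : nat); split=> [i|].
      by apply: (mult_zeros De) => D2; have /eqP := vge_deg De D2 isT; rewrite (negPf D0).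
    rewrite sE !big_ord_recl big_ord0.
    have := subset_leq_card (finset.subsetIr (S 0) (zeros D)).
    have := subset_leq_card (finset.subsetIr (S 1) (zeros D)).
    move: zD; rewrite (_ : 'C(1 + 2, 1) = 3) //.
    by move: #|_| #|_| #|_| => x y z; lia.
  exists (fun i => (i \in zeros D) : nat); split=> [i|].
    apply: (mult_zeros De) => D2.
    have : i \in zeros D by apply/(zerosP _ De)/(vge_le (isT : 1 <= 2)%N).
    by rewrite (zE eE) => /CS [_]; apply; have [x ->] := DC; apply: vgeMl.
  rewrite sE (zE eE) eE !big_ord_recl big_ord0.
  have [->|j0] := eqVneq j 0; first by rewrite finset.setIid cS cI.
  have -> : j = 1 by apply: val_inj; case: j j0 {hC Cd C0 CS DC zE} => [[|[|]]].
  by rewrite finset.setIid cS cI.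
rewrite !big_ord_recl !big_ord0 !sum_nat_const !cS.
lia.
Qed.
End Consequences.

(** * Containment *)

Section Ideals.
Variable R : comNzRingType.
Implicit Types (I J : set R) (f g : R).

Lemma ideal_gen_ideal (S : set R) : is_ideal (ideal_gen S).
Proof.
split=> [J [[J0 _ _] _] //|f g hf hg J hJ|a f hf J hJ].
- by have [[_ JD _] _] := hJ; apply: JD; [exact: hf | exact: hg].
- by have [[_ _ JM] _] := hJ; apply: JM; exact: hf.
Qed.

Lemma ideal_gen_sub (S : set R) f : S f -> ideal_gen S f.
Proof. by move=> hf J [_]; apply. Qed.

Lemma ideal_gen_min (S J : set R) : is_ideal J -> (forall f, S f -> J f) ->
  forall f, ideal_gen S f -> J f.
Proof. by move=> iJ SJ f; apply. Qed.

Lemma idealM_gen I J f g : I f -> J g -> idealM I J (f * g).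
Proof. by move=> hf hg; apply: ideal_gen_sub; exists f => //; exists g. Qed.

Lemma idealM_sum I J (T : Type) (r : seq T) (F : T -> R) :
  (forall i, idealM I J (F i)) -> idealM I J (\sum_(i <- r) F i).
Proof.
have [I0 ID _] := ideal_gen_ideal [set f * g | f in I & g in J].
by move=> h; elim/big_ind: _.
Qed.

Lemma idealM_addcl I J (A : R -> Prop) : (forall f, A f -> idealM I J f) ->
  forall f, addcl A f -> idealM I J f.
Proof.
have [I0 ID _] := ideal_gen_ideal [set f * g | f in I & g in J].
by move=> h; apply: addcl_le.
Qed.

Lemma idealM_mull I I' J J' a b f :
  (forall x, I x -> I' (a * x)) -> (forall x, J x -> J' (b * x)) ->
  idealM I J f -> idealM I' J' (a * b * f).
Proof.
move=> hI hJ; have [I0 ID IM] := ideal_gen_ideal [set f * g | f in I' & g in J'].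
apply: (@ideal_gen_min _ (fun f => idealM I' J' (a * b * f))).
  split=> [|x y hx hy|x y hy].
  - by rewrite mulr0.
  - by rewrite mulrDr; apply: ID.
  - by rewrite mulrCA; apply: IM.
move=> _ [x hx [y hy <-]]; rewrite mulrACA; apply: idealM_gen; first exact: hI.
exact: hJ.
Qed.

End Ideals.

Section PlanePoints.
Variables (K : fieldType) (n : nat).
Implicit Types (p : 'I_n -> P2 K) (f : {mpoly K[3]}).
Local Notation pi d f := (pihomog mdeg d f).

Lemma irrelevant1 f : f \is 1.-homog -> irrelevant_ideal K f.
Proof.
have [I0 ID IM] := ideal_gen_ideal [set ('X_i : {mpoly K[3]}) | i in [set: 'I_3]].
move=> /homogS_split [g [_ ->]]; elim/big_ind: _ => // i _.
by rewrite mulrC; apply: IM; apply: ideal_gen_sub; exists i.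
Qed.

Lemma irrelevantX k r f : f \is k.-homog -> (r <= k)%N -> idealX (irrelevant_ideal K) r f.
Proof.
elim: r k f => // r IH [|k] // f fk rk; have [g [gh ->]] := homogS_split fk.
apply: idealM_sum => i; apply: idealM_gen; last exact: IH (gh i) rk.
by apply: irrelevant1; apply: dhomogXU.
Qed.

Lemma coord_scale (q : P2 K) (x y : 'rV[K]_3) : is_coord q x -> is_coord q y ->
  exists c, y = c *: x.
Proof.
case: q => L dL [xL x0] [yL _]; rewrite /= in xL yL.
have Lx : L = <[x]>%VS.
  apply/esym/eqP; rewrite eqEdim -memvE xL (eqP dL) dim_vline x0 //.
by move: yL; rewrite Lx => /vlineP.
Qed.

Lemma vanishes_at_coord (q : P2 K) (x : 'rV[K]_3) d f : is_coord q x -> f \is d.-homog ->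
  f.@[x 0] = 0 -> vanishes_at f q.
Proof.
move=> qx fd fx y qy; have [c ->] := coord_scale qx qy.
have -> : f.@[(fun j => (c *: x) 0 j)] = f.@[fun j => c * x 0 j].
  by apply: meval_eq => j; rewrite mxE.
by rewrite (homog_meval_scale _ _ fd) fx mulr0.
Qed.

Variables (p : 'I_n -> P2 K) (v : 'M[K]_(n, 3)).
Hypothesis pv : forall i, is_coord (p i) (row i v).

Let rowE i f : f.@[fun j => row i v 0 j] = f.@[v i].
Proof. by apply: meval_eq => j; rewrite mxE. Qed.

Lemma points_ideal_homog d f : f \is d.-homog -> (forall i, f.@[v i] = 0) -> points_ideal p f.
Proof.
move=> fd f0 i _; apply: ideal_gen_sub; split; first by exists d.
by apply: (vanishes_at_coord (pv i) fd); rewrite rowE.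
Qed.

Variable s : nat.
Hypothesis gp : general_position s v.
Local Notation mult i := (vge (xcoord v i) (ycoord v i)).

(** Elements of the ideal power need not be forms, so the bound is put on homogeneous components,
    where it is stable under sums and multiples because components of a product are sums of products
    of components. *)
Lemma point_ideal_mult i m f : idealX (point_ideal (p i)) m f -> forall d, mult i m (pi d f).
Proof.
elim: m f => [f _ d|m IH]; first exact: vge_0.
have ideal_mult k : is_ideal (fun f => forall d, mult i k (pi d f)).
  split=> [d|f g hf hg d|f g hg d].
  - by rewrite pihomog0; apply: vge0.
  - by rewrite pihomogD; apply: vgeD.
  - by rewrite pihomogM; apply: vge_sum => j _; apply: vgeMl.
have mult1 f : point_ideal (p i) f -> forall d, mult i 1 (pi d f).
  move: f; apply: ideal_gen_min; first exact: ideal_mult.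
  move=> f [[k fk] f0] d; have [<-|kd] := eqVneq k d; last first.
    by rewrite (pihomog_ne0 kd fk); apply: vge0.
  rewrite pihomog_dE //; apply/(mult1P gp _ fk).
  by rewrite -rowE; apply: f0.
apply: ideal_gen_min; first exact: ideal_mult.
move=> _ [f hf [g hg <-]] d; rewrite pihomogM; apply: vge_sum => j _.
rewrite -add1n; apply: vgeM; first exact: mult1.
exact: IH.
Qed.

Lemma points_injective : injective p.
Proof.
move=> i j pij; apply/eqP; apply: contraT => ij.
have := points_distinct gp ij; have pj := pv j; rewrite -pij in pj.
have [c cE] := coord_scale (pv i) pj.
have vc k : v j k = c * v i k by have := congr1 (fun A : 'rV__ => A 0 k) cE; rewrite !mxE.
have c0 : c != 0.
  have [_] := pj; apply: contraNneq => c0; apply/eqP/rowP => k.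
  by rewrite !mxE vc c0 mul0r.
by rewrite /xcoord /ycoord !vc -!mulf_div divff // !mul1r eqxx.
Qed.

Local Notation target r := (idealM (idealX (irrelevant_ideal K) r) (idealX (points_ideal p) r)).

Lemma videal_target r k f : (r <= k)%N ->
  videal s (xcoord v) (ycoord v) r k f -> target r f.
Proof.
move=> rk; apply: idealM_addcl => _ [h [y [hk hy ->]]].
apply: idealM_gen; first exact: irrelevantX hk rk.
elim: r y hy {rk} => // r IH y; apply: idealM_addcl => _ [x [z [[xh x0] hz ->]]].
apply: idealM_gen; last exact: IH.
apply: (points_ideal_homog xh) => i; apply/(mult1P gp _ xh)/vge1P; exact: x0.
Qed.

(** Since [r(s+2) = r(s+1) + r], the generators of degree [r(s+1)] have cofactors of degree at least
    [r], which lie in [M^r]. *)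
Lemma high_degree_target r t F : (r * s.+2 <= t)%N -> F \is t.-homog ->
  (forall i, mult i (2 * r) F) -> target r F.
Proof.
move=> rt Ft hF; have [e [eh eE]] := points_separators gp.
have ts : (t = r * s.+1 + (t - r * s.+1))%N by rewrite subnKC // (leq_trans _ rt) // leq_mul.
apply: (@videal_target r (t - r * s.+1)).
  by rewrite leq_subRL ?(leq_trans _ rt) ?leq_mul // -mulnSr.
apply: (symbolic_form_generated (@points_distinct _ _ _ _ gp) eh eE).
  by rewrite -ts.
by move=> i; apply: vge_le (hF i); rewrite leq_pmull.
Qed.

(* For two points the degree bound fails, but a form of degree below 3r with
   multiplicity 2r at both points is divisible by the square of the line joining them. *)
Lemma two_points_target r t F : n = 2 -> s = 1%N -> F \is t.-homog ->
  (forall i, mult i (2 * r) F) -> target r F.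
Proof.
move=> n2 s1; pose A : {set 'I_n} := finset.setT.
have cA : #|A| = 2 by rewrite cardsT card_ord n2.
have inA i : i \in A by rewrite finset.in_setT.
have [||L [Lh L0 LS]] := @curve_exists _ _ _ _ gp 1 A; [by rewrite n2 | by rewrite cA |].
(* By Bezout a nonzero form of so small a degree is not coprime to [L], and a prime factor of [L] is
   [L] up to a constant. *)
have div m t' G : G \is t'.-homog -> (t' < 2 * m.+1)%N -> (forall i, mult i m.+1 G) ->
    exists G' t'', [/\ G' \is t''.-homog, (forall i, mult i m G'), G = L * G' & (t'' <= t' - 1)%N].
  move=> Gh tm hG.
  have [->|G0] := eqVneq G 0.
    exists 0, (t' - 1)%N; split; rewrite ?dhomog0 ?mulr0 // => i; exact: vge0.
  have [cop|[q [qp qG qL]]] := coprime_or_common_prime G L0.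
    have := bezout (points_distinct gp) Gh Lh G0 L0 cop hG (S := A) _.
    rewrite muln1 sum_nat_const cA leqNgt tm => H.
    by exfalso; apply: notF; apply: H => i _; case: (LS i (inA i)).
  have [c [c1 qc]] := divides_homog Lh L0 qL.
  have c0 := prime_homog_gt0 qp qc.
  have cE : c = 1%N by lia.
  rewrite cE in qc; have [x xE] := qL; rewrite xE in Lh L0.
  have [_ x0] := homog_divr Lh L0 qc; have xC := homog0_const x0.
  move: (x@_0) xC => y xC.
  have y0 : y != 0 by apply: contraNneq L0 => h; rewrite xC h mpolyC0 mul0r.
  have [G' GE] := qG; rewrite GE in Gh G0.
  have [t1 G'h] := homog_divr Gh G0 qc.
  exists (y^-1 *: G'), (t' - 1)%N; split.
  - by rewrite rpredZ.
  - move=> i; apply: vgeZ; rewrite -[m]subn0 -[(m - 0)%N]subn0.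
    have -> : (m - 0 - 0 = m.+1 - 1)%N by lia.
    apply: (@vge_cancel _ _ _ _ _ _ q); first by rewrite mulrC -GE.
    have [_ L2] := LS i (inA i).
    by apply: mult_divides L2; exists x.
  - by rewrite GE xE xC mul_mpolyC -scalerAl -scalerAr scalerA divff // scale1r mulrC.
  - by [].
elim: r t F => [t F _ _|r IH t F Ft hF].
  by rewrite -[F]mulr1; apply: idealM_gen.
have [tr|tr] := leqP (r.+1 * s.+2) t; first exact: (high_degree_target tr Ft hF).
rewrite s1 in tr.
(* Both divisions are in range: [t < 3r + 3 <= 4r + 4], and then [t1 < 3r + 2 <= 4r + 2]. *)
have [||F1 [t1 [F1h hF1 FE tt1]]] := div (2 * r).+1 t F Ft.
- by lia.
- by move=> i; apply: vge_le (hF i); rewrite mulnS.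
have [||F2 [t2 [F2h hF2 F1E _]]] := div (2 * r)%N t1 F1 F1h => //.
  by lia.
(* One factor [L] is spent on [M], the other on the ideal of the points. *)
rewrite FE F1E mulrA; apply: idealM_mull (IH _ _ F2h hF2).
  by move=> x hx; apply: idealM_gen => //; apply: irrelevant1.
move=> x hx; apply: idealM_gen => //; apply: (points_ideal_homog Lh) => i.
by apply/(mult1P gp _ Lh); case: (LS i (inA i)).
Qed.

End PlanePoints.

(** Minimality of [s] supplies enough points for the curves: three for [s = 1] once [n = 2] is
    excluded, four for [s = 2], seven for [s = 3], and ['C(s + 1, 2) + 1] beyond. For [s = 0] a
    multiplicity cannot exceed the degree. *)
Lemma degree_bound (K : fieldType) (n s : nat) (v : 'M[K]_(n, 3)) t r (F : {mpoly K[3]}) :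
  general_position s v -> (1 <= n)%N -> n != 2 -> ('C(s.-1 + 2, s.-1) < n \/ s = 0)%N ->
  F \is t.-homog -> F != 0 -> (forall i, vge (xcoord v i) (ycoord v i) (2 * r) F) ->
  (r * s.+2 <= t)%N.
Proof.
move=> gp n1 n2 hs Ft F0 hF.
pose A lo hi := [set i : 'I_n | (lo <= i < hi)%N].
have cA lo hi : (hi <= n)%N -> #|A lo hi| = count (fun k => lo <= k < hi)%N (iota 0 hi).
  by move=> hn; apply: (card_ord_pred (P := fun k => lo <= k < hi)%N) => // k /andP[].
have dA lo mi hi : (lo <= mi)%N -> [disjoint A 0%N lo & A mi hi].
  move=> lm; rewrite -finset.setI_eq0; apply/eqP/finset.setP => i; rewrite !inE /=.
  by apply/negP => /andP[h1 /andP[h2 _]]; lia.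
have lines lo hi lo' : (lo' <= lo)%N -> (2 <= lo)%N -> (hi <= n)%N -> (lo < hi)%N ->
    #|A lo' hi| = 2 -> ((2 + #|A lo hi|) * r <= t)%N.
  move=> ll l2 hn lh c2; pose S (j : 'I_2) := if j == 0 then A 0%N 2 else A lo hi.
  pose T (j : 'I_2) := if j == 0 then A 0%N 2 else A lo' hi.
  have c0 : #|A 0%N 2| = 2 by rewrite cA // (leq_trans _ hn) // (leq_trans l2 (ltnW lh)).
  have := @degree_bound_lines K n s v gp S T t r F n1 _ _ Ft F0 hF.
  rewrite /S /T /= c0; apply; last exact: dA.
  move=> j; case: (j == 0); rewrite ?c0 ?c2; split => //.
  by apply/fintype.subsetP => i; rewrite !inE => /andP[h ->]; rewrite (leq_trans ll h).
case: s gp hs => [|[|[|[|s]]]] gp hs.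
- rewrite mulnC leqNgt; apply/negP => h; move: F0.
  by rewrite (vge_deg Ft (hF (Ordinal n1)) h) eqxx.
- have n3 : (3 <= n)%N by case: hs => // h; rewrite bin0 in h; lia.
  have := lines 2 3 1 isT isT n3 isT; rewrite !cA // => /(_ erefl) /=.
  by rewrite mulnC.
- case: hs => // h; rewrite (_ : 'C(_, _) = 3) // in h.
  have := lines 2 4 2 isT isT h isT; rewrite !cA // => /(_ erefl) /=.
  by rewrite mulnC.
- case: hs => // h; rewrite (_ : 'C(_, _) = 6) // in h.
  by rewrite mulnC; apply: (degree_bound_conics gp h Ft F0 hF).
- case: hs => //= h; have := degree_bound_curve gp _ (ltnW h) Ft F0 hF.
  by rewrite addn3; apply.
Qed.

Local Open Scope classical_set_scope.

Theorem proposition3p10 (K : fieldType) (n : nat)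
    (K_infinite : infinite_set [set: K]) (n_ge1 : (1 <= n)%N) :
  for_general_points (fun p : 'I_n -> P2 K =>
    injective p /\
    forall r : nat, (1 <= r)%N ->
      symbolic_power p (2 * r) `<=`
        idealM (idealX (irrelevant_ideal K) r) (idealX (points_ideal p) r)).
Proof.
have exs : exists s, (n <= 'C(s + 2, s))%N.
  by exists n; have := tri_bin n; nia.
case: (ex_minnP exs) => s ns smin.
have hs : ('C(s.-1 + 2, s.-1) < n \/ s = 0)%N.
  case: s ns smin => [|s] ns smin; [by right | left].
  by rewrite ltnNge; apply/negP => /smin; rewrite ltnn.
have [F [[dd Fdd] F0 FP]] := general_position_open K_infinite ns.
(* One choice of coordinates with nonzero [F] suffices for [p] to be in the open set: the complement
   is then the locus where [F] vanishes for all choices, as closedness requires. *)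
pose good (p : 'I_n -> P2 K) (v : 'M[K]_(n, 3)) := (forall i, is_coord (p i) (row i v)) /\
  F.@[fun k => mxvec v 0 k] != 0.
exists [set p | exists v, good p v]; split.
- exists [set F]; split=> [_ ->|]; first by exists dd.
  apply/seteqP; split=> p /= h.
    move=> _ -> v pv; apply/eqP/negPn/negP => Fv; apply: h; exists v; split=> // i.
  by move=> [v [pv /eqP]]; apply; apply: h.
- have [w Fw] := nonvanishing_point K_infinite F0.
  pose v : 'M[K]_(n, 3) := vec_mx (\row_k w k).
  have Fv : F.@[fun k => mxvec v 0 k] != 0.
    suff -> : F.@[fun k => mxvec v 0 k] = F.@[w] by [].
    by apply: meval_eq => k; rewrite vec_mxK mxE.
  have v0 i : row i v != 0.
    have [/(_ i) h _ _ _] := FP v Fv; apply: contraNneq h => /(congr1 (fun A : 'rV__ => A 0 i0)).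
    by rewrite !mxE => ->.
  have vL i : \dim <[row i v]>%VS == 1%N by rewrite dim_vline v0.
  exists (fun i => exist (fun L : {vspace 'rV[K]_3} => is_true (\dim L == 1%N)) _ (vL i)), v; split=> // i.
  by split; [exact: memv_line | exact: v0].
move=> p [v [pv Fv]]; have gp := FP v Fv; split; first exact: points_injective pv _ gp.
(* The target ideal is additive and multiplicities are read off on homogeneous components, so [f]
   may be replaced by one of these. *)
move=> r r1 f hf; rewrite (pihomog_partitionE (leqnn (msize f))).
apply: idealM_sum => d; set g := pihomog _ _ _.
have gd : g \is d.-homog by apply: pihomogP.
have hg i : vge (xcoord v i) (ycoord v i) (2 * r) g.
  by apply: (point_ideal_mult pv gp); apply: hf.
have [g0|g0] := eqVneq g 0.
  rewrite g0; have [//] := ideal_gen_ideal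
    [set f * g | f in idealX (irrelevant_ideal K) r & g in idealX (points_ideal p) r].
have [n2|n2] := eqVneq n 2.
  apply: (two_points_target pv gp n2 _ gd hg).
  apply/eqP; rewrite eqn_leq smin ?n2 // lt0n.
  by apply: contraTneq ns => ->; rewrite n2.
apply: (high_degree_target pv gp _ gd hg).
exact: degree_bound gp n_ge1 n2 hs gd g0 hg.
Qed.
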